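(* Let $K_0>0$, $\alpha>-1$, $\beta>-1$, $h_0\in\mathbb R$. (1) Every solution $v$ of $-\Delta v=2K_0|x|^{2\alpha}e^v$ in $\mathbb R^2$ satisfies $\mathrm{ind}(v)\ge1$; moreover, if $\int_{\mathbb R^2}|x|^{2\alpha}e^v=\infty$ then $\mathrm{ind}(v)=\infty$. (2) Every solution $v$ of $-\Delta v=2K_0|x|^{2\beta}e^v$ in $\mathbb R^2_+$, $\partial_\nu v=2h_0|x|^\beta e^{v/2}$ on $\partial\mathbb R^2_+$, satisfies $\mathrm{ind}(v)\ge1$; moreover, if $\int_{\mathbb R^2_+}|x|^{2\beta}e^v=\infty$ then $\mathrm{ind}(v)=\infty$.
   Context: $\mathbb R^2_+=\{(s,t)\in\mathbb R^2:t\ge0\}$, $\nu$ the outward normal on $\partial\mathbb R^2_+$. Solutions are classical solutions smooth away from the origin with $|x|^{2\alpha}e^v$ (resp. $|x|^{2\beta}e^v$) locally integrable. For (1): $\mathcal Q_v[\phi,\phi]=\int_{\mathbb R^2}\left(|\nabla\phi|^2-2K_0|x|^{2\alpha}e^v\phi^2\right)$ and $\mathrm{ind}(v)=\sup\{\dim E:\ E\subset C^\infty_c(\mathbb R^2),\ \mathcal Q_v[\phi,\phi]<0\ \forall\phi\in E\setminus\{0\}\}$. For (2): $\mathcal Q_v[\phi,\phi]=\int_{\mathbb R^2_+}\left(|\nabla\phi|^2-2K_0|x|^{2\beta}e^v\phi^2\right)-\int_{\partial\mathbb R^2_+}h_0|x|^\beta e^{v/2}\phi^2$ and $\mathrm{ind}(v)=\sup\{\dim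 E:\ E\subset C^\infty_c(\overline{\mathbb R^2_+}),\ \mathcal Q_v[\phi,\phi]<0\ \forall\phi\in E\setminus\{0\}\}$, where $C^\infty_c(\overline{\mathbb R^2_+})$ denotes smooth functions with compact support in the closed half-plane. *)

(* Defs.v *)
From HB Require Import structures.
From mathcomp Require Import all_boot all_order all_algebra.
From mathcomp Require Import all_classical all_reals all_analysis.
Set Implicit Arguments. Unset Strict Implicit. Unset Printing Implicit Defensive.
Import Order.TTheory GRing.Theory Num.Theory numFieldNormedType.Exports.
Local Open Scope classical_set_scope.
Local Open Scope ring_scope.

Section Defs.
Variable R : realType.

Definition e1 : R * R := (1, 0).
Definition e2 : R * R := (0, 1).

(* Euclidean norm |x| (the library norm on R*R is the max norm) *)
Definition enorm (x : R * R) : R := Num.sqrt (x.1 ^+ 2 + x.2 ^+ 2).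

Fixpoint iter_partial (l : seq bool) (f : R * R -> R) : R * R -> R :=
  match l with
  | [::] => f
  | b :: l' => 'D_(if b then e2 else e1) (iter_partial l' f)
  end.

Definition smooth_on (U : set (R * R)) (f : R * R -> R) : Prop :=
  open U /\ forall (l : seq bool) (x : R * R), U x -> differentiable (iter_partial l f) x.

Definition laplacian (f : R * R -> R) (x : R * R) : R :=
  'D_e1 ('D_e1 f) x + 'D_e2 ('D_e2 f) x.

Definition grad2 (f : R * R -> R) (x : R * R) : R :=
  ('D_e1 f x) ^+ 2 + ('D_e2 f x) ^+ 2.

Definition leb2 := (@lebesgue_measure R \x @lebesgue_measure R)%E.

Definition cl_half : set (R * R) := [set x | 0 <= x.2].
Definition op_half : set (R * R) := [set x | 0 < x.2].
Definition punct : set (R * R) := [set x | x != (0, 0)].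

Definition smooth_upto (A : set (R * R)) (f : R * R -> R) : Prop :=
  exists U : set (R * R), exists g : R * R -> R,
    A `<=` U /\ smooth_on U g /\ (forall x, A x -> g x = f x).

Definition test_fun (phi : R * R -> R) : Prop :=
  smooth_on setT phi /\ compact (closure [set x | phi x != 0]).

Definition test_fun_half (phi : R * R -> R) : Prop :=
  smooth_upto cl_half phi /\ compact (closure ([set x | phi x != 0] `&` cl_half)).

Definition weight (a : R) (v : R * R -> R) (x : R * R) : R :=
  (enorm x `^ (2 * a)) * expR (v x).

Definition loc_integrable (D : set (R * R)) (w : R * R -> R) : Prop :=
  forall K : set (R * R), compact K -> K `<=` D ->
    leb2.-integrable K (fun x => (w x)%:E).

Definition solution1 (K0 alpha : R) (v : R * R -> R) : Prop :=
  smooth_on punct v /\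
  (forall x, punct x -> - laplacian v x = 2 * K0 * weight alpha v x) /\
  loc_integrable setT (weight alpha v).

(* classical solution of (2); outward normal is (0,-1), so
   d_nu v = - d_t v on the boundary *)
Definition solution2 (K0 h0 beta : R) (v : R * R -> R) : Prop :=
  smooth_upto (cl_half `&` punct) v /\
  (forall x, op_half x -> - laplacian v x = 2 * K0 * weight beta v x) /\
  (forall U g, cl_half `&` punct `<=` U -> smooth_on U g ->
     (forall x, (cl_half `&` punct) x -> g x = v x) ->
     forall s : R, s != 0 ->
       - 'D_e2 g (s, 0) = 2 * h0 * (enorm (s, 0) `^ beta) * expR (v (s, 0) / 2)) /\
  loc_integrable cl_half (weight beta v).

Definition Q1 (K0 alpha : R) (v phi : R * R -> R) : \bar R :=
  (\int[leb2]_x (grad2 phi x - 2 * K0 * weight alpha v x * phi x ^+ 2)%:E)%E.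

Definition Q2 (K0 h0 beta : R) (v phi : R * R -> R) : \bar R :=
  (\int[leb2]_(x in op_half) (grad2 phi x - 2 * K0 * weight beta v x * phi x ^+ 2)%:E
   - \int[@lebesgue_measure R]_s
       (h0 * (enorm (s, 0) `^ beta) * expR (v (s, 0) / 2) * phi (s, 0) ^+ 2)%:E)%E.

(* There is a k-dimensional subspace E of the test space on which Q is negative
   definite: E is the span of phi_0..phi_{k-1}; negativity of Q on every
   nonzero element of the span (c <> 0) forces linear independence, so dim E = k. *)
Definition neg_subspace_dim (test : (R * R -> R) -> Prop)
    (Q : (R * R -> R) -> \bar R) (k : nat) : Prop :=
  exists phi : 'I_k -> R * R -> R,
    (forall i, test (phi i)) /\
    forall c : 'I_k -> R, c <> (fun _ => 0) ->
      (Q (fun x => (\sum_(i < k) c i * phi i x)%R) < 0)%E.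

Definition morse_index (test : (R * R -> R) -> Prop)
    (Q : (R * R -> R) -> \bar R) : \bar R :=
  ereal_sup [set (k%:R)%:E | k in neg_subspace_dim test Q].

Definition ind1 (K0 alpha : R) (v : R * R -> R) : \bar R :=
  morse_index test_fun (Q1 K0 alpha v).

Definition ind2 (K0 h0 beta : R) (v : R * R -> R) : \bar R :=
  morse_index test_fun_half (Q2 K0 h0 beta v).

End Defs.

(* Main.v *)
Require Import Defs.
From HB Require Import structures.
From mathcomp Require Import all_boot all_order all_algebra.
From mathcomp Require Import all_classical all_reals all_analysis.
From mathcomp Require Import measurable_realfun.
From mathcomp Require Import ring lra.
Set Implicit Arguments. Unset Strict Implicit. Unset Printing Implicit Defensive.
Import Order.TTheory GRing.Theory Num.Theory numFieldNormedType.Exports.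
Local Open Scope classical_set_scope.
Local Open Scope ring_scope.

(** Write [rho] for |x|^2 and w for the weight |x|^(2a) e^v. In dimension two the logarithmic
    cutoffs b((ln rho - c) / n) have Dirichlet energy O(1/n): |grad ln rho|^2 = 4 / rho, and the
    integral of 1 / rho over a shell grows only linearly with its width in ln rho. The negative part
    of the form is at least a constant times the mass of w on the inner shell |ln rho - c| <= n. So
    the form is negative on a cutoff as soon as this mass exceeds a fixed multiple of 1/n
    ([energy_le]).

    With c = 0 and n large this gives index at least 1, the mass of the unit shell being positive
    ([index_ge1]). If the total mass is infinite, cut the range of ln rho into dyadic intervals,
    with n = 2^j. Were the energies nonnegative from some j on, the masses would be dominated by a
    geometric series and the total mass would be finite. Hence negative energies occur for
    arbitrarily large j ([frequently_negative_energy]); sparse choices of j give cutoffs with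
    disjoint supports, on which the form is diagonal, in any number ([index_infinite]).

    In the half-plane the boundary integral has arbitrary sign. It is removed by testing with eta
    psi, where psi = exp(u / 2) and u = v + (be + 1) ln rho is [conf]. Since u has Laplacian -2 K0 w
    and outward normal derivative 2 h0 |x|^be e^(v/2), the divergence of eta^2 psi grad psi
    integrates exactly to the boundary term. What remains is the integral of psi^2 (|grad eta|^2 -
    eta^2 (K0 w + |grad u|^2 / 4)) ([Q2_transformed]). As psi^2 = w rho, completing a square bounds
    the integrand by n^-2 times a density of the same shape as in the plane ([half_density_le]).
    Both cases therefore follow from the abstract criterion of section [IndexCriterion]. *)

(** * Calculus of functions smooth along chosen directions *)

Section DirectionalSmoothness.
Variables (R : realType) (T : normedModType R) (I : Type) (dir : I -> T).
Implicit Types (f g : T -> R) (U : set T).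

(* Only derivatives along the chosen directions are iterated: [dir] lists the
   coordinate vectors, of R for functions of one variable, of R * R for two. *)
Fixpoint diffn (n : nat) U f : Prop :=
  (forall x, U x -> differentiable f x) /\
  (if n is m.+1 then forall i, diffn m U ('D_(dir i) f) else True).

Definition csmooth U f := forall n, diffn n U f.

Lemma csmooth_diff U f x : csmooth U f -> U x -> differentiable f x.
Proof. by move=> /(_ 0%N)[+ _]; exact. Qed.

Lemma csmooth_derive U f i : csmooth U f -> csmooth U ('D_(dir i) f).
Proof. by move=> sf n; case: (sf n.+1) => _; exact. Qed.

Lemma diffn_le1 n U f : diffn n.+1 U f -> diffn n U f.
Proof.
elim: n f => [|n IH] f /= [df Df]; first by split.
by split=> // i; apply: IH; exact: Df.
Qed.

Lemma diffn_sub n U V f : U `<=` V -> diffn n V f -> diffn n U f.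
Proof.
move=> UV; elim: n f => [|n IH] f /= [df Df]; split=> //.
- by move=> x /UV /df.
- by move=> x /UV /df.
- by move=> i; exact: IH.
Qed.

Lemma csmooth_sub U V f : U `<=` V -> csmooth V f -> csmooth U f.
Proof. by move=> UV sf n; exact: diffn_sub (sf n). Qed.

Lemma csmoothU U V f : csmooth U f -> csmooth V f -> csmooth (U `|` V) f.
Proof.
move=> sf sg n; elim: n f sf sg => [|n IH] f sf sg; split=> //.
- by move=> x [] ?; [exact: csmooth_diff sf _|exact: csmooth_diff sg _].
- by move=> x [] ?; [exact: csmooth_diff sf _|exact: csmooth_diff sg _].
- by move=> i; apply: IH; exact: csmooth_derive.
Qed.

Lemma near_open_eq U f g x : open U -> (forall y, U y -> f y = g y) -> U x ->
  \near x, f x = g x.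
Proof.
move=> oU fg Ux; apply: filterS (open_nbhs_nbhs (conj oU Ux)).
by move=> y /fg.
Qed.

(** Differentiability is local: the expansion of [f] at [x] is also one for [g]. *)
Lemma near_eq_differentiable f g x :
  (\near x, f x = g x) -> differentiable f x -> differentiable g x.
Proof.
move=> fg /diffP[df fE]; apply/diffP => /=.
(* The differential of [g] is by definition a chosen linear map satisfying this expansion, so
   exhibiting one such map, ['d f x], suffices. *)
apply: (@getPex _ (fun d : {linear T -> R} => continuous d /\
  forall y, g y = g (lim (nbhs x)) + d (y - lim (nbhs x))
                  +o_(y \near x) (y - lim (nbhs x)))).
exists ('d f x); split=> //.
suff : g = cst (g (lim (nbhs x))) + 'd f x \o center (lim (nbhs x))
    +o_x (center (lim (nbhs x))) by move=> {1}-> y.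
apply/eqaddoP => e e0; move/funext/eqaddoP : fE => /(_ e e0) fo.
rewrite lim_id// in fo *; near=> y.
have -> : (g - (cst (g x) + 'd f x \o center x)) y =
          (f - (cst (f x) + 'd f x \o center x)) y.
  by rewrite /= !fctE/= (nbhs_singleton fg) (near fg y).
by near: y.
Unshelve. all: by end_near. Qed.

(** Openness of [U] makes the equality hold near each point. This is what allows a derivative to be
    replaced by a formula valid on [U] only. *)
Lemma diffn_eq n U f g : open U -> (forall x, U x -> f x = g x) ->
  diffn n U f -> diffn n U g.
Proof.
move=> oU; elim: n f g => [|n IH] f g fg [df Df]; split=> //.
- by move=> x Ux; apply: near_eq_differentiable (df x Ux); exact: near_open_eq fg Ux.
- by move=> x Ux; apply: near_eq_differentiable (df x Ux); exact: near_open_eq fg Ux.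
- move=> i; apply: IH (Df i) => x Ux.
  by apply: near_eq_derive; exact: near_open_eq fg Ux.
Qed.

Lemma csmooth_eq U f g : open U -> (forall x, U x -> f x = g x) ->
  csmooth U f -> csmooth U g.
Proof. by move=> oU fg sf n; exact: diffn_eq fg (sf n). Qed.

Lemma csmooth_cst U (c : R) : csmooth U (cst c).
Proof.
move=> n; elim: n c => [|n IH] c; split=> // i.
suff -> : 'D_(dir i) (cst c : T -> R) = cst 0 by exact: IH.
by apply/funext => x; exact: derive_cst.
Qed.

Lemma diffnD n U f g : open U -> diffn n U f -> diffn n U g ->
  diffn n U (fun x => f x + g x).
Proof.
move=> oU; elim: n f g => [|n IH] f g [df Df] [dg Dg]; split=> //.
- by move=> x Ux; apply: differentiableD; [exact: df|exact: dg].
- by move=> x Ux; apply: differentiableD; [exact: df|exact: dg].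
- move=> i; apply: (diffn_eq (f := fun x => 'D_(dir i) f x + 'D_(dir i) g x)) => //.
    move=> x Ux; rewrite [RHS]deriveD//; apply: diff_derivable;
      [exact: df|exact: dg].
  exact: IH (Df i) (Dg i).
Qed.

Lemma csmoothD U f g : open U -> csmooth U f -> csmooth U g ->
  csmooth U (fun x => f x + g x).
Proof. by move=> oU sf sg n; exact: diffnD. Qed.

Lemma deriveM_at f g i x : differentiable f x -> differentiable g x ->
  'D_(dir i) (fun x => f x * g x) x
    = f x * 'D_(dir i) g x + g x * 'D_(dir i) f x.
Proof.
by move=> df dg; rewrite [LHS]deriveM//; exact: diff_derivable.
Qed.

Lemma diffnM n U f g : open U -> diffn n U f -> diffn n U g ->
  diffn n U (fun x => f x * g x).
Proof.
move=> oU; elim: n f g => [|n IH] f g fn gn.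
  case: fn gn => df _ [dg _].
  by split=> // x Ux; apply: differentiableM; [exact: df|exact: dg].
have [[df Df] [dg Dg]] := (fn, gn); split.
  by move=> x Ux; apply: differentiableM; [exact: df|exact: dg].
move=> i; apply: (diffn_eq (f := fun x =>
    f x * 'D_(dir i) g x + g x * 'D_(dir i) f x)) => //.
  by move=> x Ux; rewrite deriveM_at//; [exact: df|exact: dg].
(* In each product of the Leibniz rule one factor is left underived; [diffn_le1] lowers its order to
   that of the other. *)
by apply: diffnD => //; apply: IH; (exact: Df || exact: Dg || exact: (diffn_le1 fn) || exact: (diffn_le1 gn)).
Qed.

Lemma csmoothM U f g : open U -> csmooth U f -> csmooth U g ->
  csmooth U (fun x => f x * g x).
Proof. by move=> oU sf sg n; exact: diffnM. Qed.

Lemma csmooth_sum U k (F : 'I_k -> T -> R) : open U ->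
  (forall i, csmooth U (F i)) -> csmooth U (fun x => \sum_(i < k) F i x).
Proof.
move=> oU; elim: k F => [|k IH] F sF.
  rewrite (_ : (fun x => _) = cst 0); first exact: csmooth_cst.
  by apply/funext => x; rewrite big_ord0.
rewrite (_ : (fun x => _) =
  fun x => F ord0 x + \sum_(i < k) F (lift ord0 i) x).
  by apply: csmoothD => //; exact: IH.
by apply/funext => x; rewrite big_ord_recl.
Qed.

End DirectionalSmoothness.

(** * Smoothness in one and two variables, chain rule, elementary functions *)

Section OneAndTwoVariables.
Variable R : realType.
Implicit Types (h : R -> R) (f g : R * R -> R) (U : set (R * R)) (V : set R).

Definition smooth1 V h := csmooth (fun _ : unit => 1 : R) V h.

Definition axis (b : bool) : R * R := if b then e2 R else e1 R.

Lemma smooth_onP U f : smooth_on U f <-> open U /\ csmooth axis U f.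
Proof.
split=> -[oU sf]; split=> //.
  move=> n; elim: n f sf => [|n IH] f sf; split.
  - exact: (sf [::]).
  - by [].
  - exact: (sf [::]).
  - move=> b; apply: IH => l x Ux.
    suff -> : iter_partial l ('D_(axis b) f) = iter_partial (rcons l b) f by exact: sf.
    by elim: l => //= c l ->.
move=> l; elim/last_ind: l f sf => [|l b IH] f sf x Ux.
  exact: csmooth_diff sf Ux.
suff <- : iter_partial l ('D_(axis b) f) = iter_partial (rcons l b) f.
  by apply: IH => //; exact: csmooth_derive.
by elim: l {IH} => //= c l ->.
Qed.

Lemma derive_comp1 (T : normedModType R) (v : T) h (f : T -> R) x :
  derivable h (f x) 1 -> differentiable f x ->
  'D_v (h \o f) x = h^`()%classic (f x) * 'D_v f x.
Proof.
move=> /derivable1_diffP dh df.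
rewrite deriveE; last exact: differentiable_comp.
rewrite diff_comp//= [in RHS]deriveE// derive1E deriveE//.
by rewrite -{1}['d f x v]mulr1 [LHS]linearZ /= mulrC.
Qed.

(** A derivative of [h \o f] is [h' \o f] times a derivative of [f], so the induction on the order
    runs over all smooth [h] with [f] fixed. *)
Lemma csmooth_comp (T : normedModType R) (I : Type) (dir : I -> T) (U : set T) V
    h (f : T -> R) :
  open U -> smooth1 V h -> csmooth dir U f -> (forall x, U x -> V (f x)) ->
  csmooth dir U (h \o f).
Proof.
move=> oU sh sf UV n; elim: n h sh => [|n IH] h sh.
  split=> // x Ux; apply: differentiable_comp; first exact: csmooth_diff sf Ux.
  exact: csmooth_diff sh (UV _ Ux).
split.
  move=> x Ux; apply: differentiable_comp; first exact: csmooth_diff sf Ux.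
  exact: csmooth_diff sh (UV _ Ux).
move=> i; apply: (diffn_eq (f := fun x => (h^`()%classic \o f) x * 'D_(dir i) f x)) => //.
  move=> x Ux; rewrite derive_comp1//.
    by apply/derivable1_diffP; exact: csmooth_diff sh (UV _ Ux).
  exact: csmooth_diff sf Ux.
apply: diffnM => //; last exact: (csmooth_derive i sf).
apply: IH.
rewrite (_ : h^`()%classic = 'D_1 h).
  exact: (csmooth_derive tt sh).
by apply/funext => y; rewrite derive1E.
Qed.

Lemma smooth1_id V : smooth1 V id.
Proof.
move=> [|n]; split=> // _.
suff -> : 'D_1 (id : R -> R) = cst 1 by exact: csmooth_cst.
by apply/funext => x; exact: derive_id.
Qed.

Lemma derive_fst (x v : R * R) : 'D_v (fst : R * R -> R) x = v.1.
Proof.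
rewrite deriveE; last first.
  by apply: linear_differentiable => y; exact: cvg_fst.
by rewrite diff_lin// => y; exact: cvg_fst.
Qed.

Lemma derive_snd (x v : R * R) : 'D_v (snd : R * R -> R) x = v.2.
Proof.
rewrite deriveE; last first.
  by apply: linear_differentiable => y; exact: cvg_snd.
by rewrite diff_lin// => y; exact: cvg_snd.
Qed.

Lemma csmooth_fst U : csmooth axis U (fst : R * R -> R).
Proof.
move=> [|n]; split=> //.
- by move=> x _; apply: linear_differentiable => y; exact: cvg_fst.
- by move=> x _; apply: linear_differentiable => y; exact: cvg_fst.
- move=> b; rewrite (_ : 'D_(axis b) _ = cst (axis b).1); first exact: csmooth_cst.
  by apply/funext => x; rewrite derive_fst.
Qed.

Lemma csmooth_snd U : csmooth axis U (snd : R * R -> R).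
Proof.
move=> [|n]; split=> //.
- by move=> x _; apply: linear_differentiable => y; exact: cvg_snd.
- by move=> x _; apply: linear_differentiable => y; exact: cvg_snd.
- move=> b; rewrite (_ : 'D_(axis b) _ = cst (axis b).2); first exact: csmooth_cst.
  by apply/funext => x; rewrite derive_snd.
Qed.

Lemma smooth1_expR V : smooth1 V (expR : R -> R).
Proof.
move=> n; elim: n => [|n IH]; split=> //.
- by move=> x _; apply/derivable1_diffP; exact: derivable_expR.
- by move=> x _; apply/derivable1_diffP; exact: derivable_expR.
- by move=> _; rewrite derive_expR.
Qed.

Lemma smooth1_inv : smooth1 [set t : R | 0 < t] (fun t => t^-1).
Proof.
have oP : open [set t : R | 0 < t] by exact: open_gt.
have dV (t : R) : 0 < t -> derivable (fun t : R => t^-1) t 1.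
  move=> t0; apply: derivableV; [by rewrite gt_eqF|exact: derivable_id].
move=> n; elim: n => [|n IH]; split=> //.
- by move=> t t0; apply/derivable1_diffP; exact: dV.
- by move=> t t0; apply/derivable1_diffP; exact: dV.
- move=> _; apply: (diffn_eq (f := fun t : R => -1 * (t^-1 * t^-1))) => //.
    move=> t t0; rewrite deriveV ?gt_eqF//.
    by rewrite derive_id -exprVn expr2 mulN1r /GRing.scale /= mulr1.
  apply: diffnM => //; first exact: (csmooth_cst (fun _ : unit => 1 : R)).
  exact: diffnM.
Qed.

Lemma smooth1_ln : smooth1 [set t : R | 0 < t] (@ln R).
Proof.
have oP : open [set t : R | 0 < t] by exact: open_gt.
move=> [|n]; split=> //.
- by move=> t t0; apply/derivable1_diffP; apply: ex_derive; exact: is_derive1_ln.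
- by move=> t t0; apply/derivable1_diffP; apply: ex_derive; exact: is_derive1_ln.
- move=> _; apply: (diffn_eq _ _ (smooth1_inv n)) => // t t0.
  by have [_ ->] := is_derive1_ln t0.
Qed.

End OneAndTwoVariables.

(** * A smooth bump function b with b'^2 <= C b *)

Section Bump.
Variable R : realType.
Implicit Types (x y s : R) (k : nat).

(** For positive [k], raise y / k <= exp(y / k) to the power [k]. *)
Lemma expr_le_expR k y : 0 <= y -> y ^+ k <= k%:R ^+ k * expR y.
Proof.
move=> y0; case: k => [|k]; first by rewrite !expr0 mul1r -expR0 ler_expR.
have k0 : 0 < k.+1%:R :> R by rewrite ltr0n.
have -> : expR y = expR (y / k.+1%:R) ^+ k.+1.
  by rewrite -expRM_natl mulrC divfK// gt_eqF.
rewrite -exprMn ler_pXn2r ?nnegrE ?mulr_ge0 ?expR_ge0//.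
rewrite -ler_pdivrMl// mulrC.
apply: le_trans (expR_ge1Dx _).
by rewrite lerDr ler01.
Qed.

(** The powers of 1/x are carried along because the derivative of one member of the family is a
    combination of two others; smoothness of all of them then follows by one induction. *)
Definition flat k x : R := if 0 < x then x^-1 ^+ k * expR (- x^-1) else 0.

Lemma flat_ge0 k x : 0 <= flat k x.
Proof.
rewrite /flat; case: ifP => // x0.
by rewrite mulr_ge0 ?expR_ge0// exprn_ge0// invr_ge0 ltW.
Qed.

Lemma flat_le k j x : 0 <= x -> flat k x <= (k + j)%:R ^+ (k + j) * x ^+ j.
Proof.
move=> x0; rewrite /flat; case: ifP => [{}x0|_]; last first.
  by rewrite mulr_ge0// exprn_ge0.
rewrite expRN ler_pdivrMr ?expR_gt0// mulrAC -ler_pdivrMr ?exprn_gt0//.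
by rewrite -exprVn -exprD expr_le_expR// invr_ge0 ltW.
Qed.

Lemma flat_derive k x :
  is_derive x (1 : R) (flat k) (flat k.+2 x - k%:R * flat k.+1 x).
Proof.
have [x0|x0|->] := ltgtP x 0.
- have fx0 j : flat j x = 0 by rewrite /flat ltNge ltW.
  rewrite !fx0 mulr0 subr0; apply: (@near_eq_is_derive _ _ _ (cst 0)).
    near=> y; rewrite /flat ifF//; apply/negbTE; rewrite -leNgt ltW//.
    by near: y; exact: lt_nbhsl.
- have pE y : ((fun y : R => y^-1) ^+ k) y = y^-1 ^+ k.
    by elim: (k) => [|j IH]; rewrite ?expr0// !exprS -IH.
  apply: (@near_eq_is_derive _ _ _ ((fun y => y^-1) ^+ k * (fun y => expR (- y^-1)))).
    near=> y; rewrite /flat ifT; first by rewrite /= ?fctE ?pE.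
    by near: y; exact: lt_nbhsr.
  have dV : is_derive x (1 : R) (fun y : R => y^-1) (- x ^- 2).
    split; first by apply: derivableV; [rewrite gt_eqF|exact: derivable_id].
    by rewrite deriveV ?gt_eqF// derive_id /GRing.scale /= mulr1.
  have dE : is_derive x (1 : R) (fun y => expR (- y^-1)) (x ^- 2 * expR (- x^-1)).
    have d1 : derivable (fun y : R => - y^-1) x 1 by apply: derivableN; case: dV.
    split.
      apply: diff_derivable; apply: (@differentiable_comp _ _ _ _ (fun y => - y^-1) expR).
        exact/derivable1_diffP.
      exact/derivable1_diffP/derivable_expR.
    rewrite -derive1E (@derive1_comp _ (fun y => - y^-1) expR)//.
    rewrite !derive1E deriveN; last by case: dV.
    by case: dV => _ ->; rewrite derive_val opprK mulrC.
  apply: is_derive_eq; rewrite /flat x0 /GRing.scale /= !fctE.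
  rewrite ?pE.
  have x2 : x ^- 2 = x^-1 ^+ 2 by rewrite exprVn.
  rewrite x2; case: (k) => [|j]; first by rewrite /=; ring.
  by rewrite /= !exprS expr0; ring.
- have f0 j : flat j 0 = 0 by rewrite /flat ltxx.
  rewrite !f0 mulr0 subr0.
  have key : h^-1 *: ((flat k) (h *: 1 + 0) - flat k 0) @[h --> 0^'] --> 0.
    (* At the origin [flat_le] with exponent 2 bounds [flat k h] by a constant times h^2, so the
       difference quotient is O(|h|). *)
    apply/cvgr0Pnorm_lt => e e0.
    pose C : R := (k + 2)%:R ^+ (k + 2).
    have C0 : 0 < C by rewrite exprn_gt0// ltr0n addn2.
    near=> h.
    have h0 : h != 0 by near: h; exact: nbhs_dnbhs_neq.
    rewrite f0 subr0 addr0 /GRing.scale /= mulr1.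
    have : flat k h <= C * `|h| ^+ 2.
      have [h1|h1] := leP 0 h; first by rewrite ger0_norm//; exact: flat_le.
      by rewrite /flat ltNge (ltW h1)/= mulr_ge0 ?exprn_ge0 ?normr_ge0// ltW.
    rewrite normrM (ger0_norm (flat_ge0 _ _)) normfV => fle.
    rewrite mulrC ltr_pdivrMr ?normr_gt0//; apply: le_lt_trans fle _.
    rewrite expr2 mulrA ltr_pM2r ?normr_gt0// mulrC -ltr_pdivlMr//.
    by near: h; apply: dnbhs0_lt; rewrite divr_gt0.
  by split; [apply/cvg_ex; exists 0|exact: cvg_lim key].
Unshelve. all: by end_near. Qed.

Lemma smooth1_flat k (V : set R) : open V -> smooth1 V (flat k).
Proof.
move=> oV n; elim: n k => [|n IH] k; split=> //.
- by move=> x _; apply/derivable1_diffP; case: (flat_derive k x).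
- by move=> x _; apply/derivable1_diffP; case: (flat_derive k x).
- move=> _; apply: (diffn_eq (f := fun x =>
      flat k.+2 x + (- k%:R) * flat k.+1 x)) => //.
    by move=> x _; case: (flat_derive k x) => _ ->; rewrite mulNr.
  apply: diffnD => //; apply: diffnM => //.
  exact: csmooth_cst.
Qed.

(** The bump is a square chi^2, so b'^2 = 4 chi'^2 b is bounded by a multiple of [b] itself. A bound
    on b' alone would not do in the half-plane, where the gradient term must carry a factor of the
    cutoff. *)
Lemma exists_bump : exists (b : R -> R) (C c : R),
  [/\ 0 < C, 0 < c & smooth1 setT b] /\
  [/\ forall s, 0 <= b s <= 1,
      forall s, b^`()%classic s ^+ 2 <= C * b s,
      forall s, `|s| <= 1 -> c <= b s &
      forall s, 2 <= `|s| -> b s = 0].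
Proof.
pose q s : R := 4 - s ^+ 2.
pose chi s : R := flat 0 (q s).
have sq : smooth1 setT q.
  rewrite (_ : q = fun s => 4 + (-1) * (s * s)); last first.
    by apply/funext => s; rewrite /q expr2; ring.
  have id1 := @smooth1_id R setT.
  apply: csmoothD; [exact: openT|exact: csmooth_cst|].
  apply: csmoothM; [exact: openT|exact: csmooth_cst|].
  by apply: csmoothM => //; exact: openT.
have schi : smooth1 setT chi.
  apply: (@csmooth_comp R R unit (fun _ => 1) setT setT (flat 0) q) => //;
    [exact: openT|by apply: smooth1_flat; exact: openT].
have dq s : q^`()%classic s = - 2 * s.
  rewrite derive1E /q; have := @is_deriveX R R id 2 s 1 1 (is_derive_id _ _).
  move=> d2; have [_ ->] := is_deriveB (is_derive_cst (4 : R) s 1) d2.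
  by rewrite /GRing.scale /= expr1 mulr1 sub0r mulNr.
have dchi s : 'D_1 chi s = (flat 2 (q s)) * (- 2 * s).
  rewrite derive_comp1; last 2 first.
  - by case: (flat_derive 0 (q s)).
  - exact: csmooth_diff sq I.
  rewrite derive1E; case: (flat_derive 0 (q s)) => _ ->.
  by rewrite mul0r subr0 -derive1E dq.
(* Here b'^2 = 16 chi^2 (flat 2 (q s))^2 s^2, where the last two factors are at most 16 and 4 on the
   support. For |s| <= 1 one has q s >= 3, hence chi s >= exp(-1/3). *)
exists (fun s => chi s * chi s), (16 * (16 * 4)), (expR (- 3^-1) ^+ 2).
have chi01 s : 0 <= chi s <= 1.
  rewrite flat_ge0 /= /chi; have [q0|q0] := leP 0 (q s).
    by apply: le_trans (flat_le 0 0 q0) _; rewrite !expr0 mulr1.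
  by rewrite /flat ltNge (ltW q0).
split; first split.
- by rewrite !mulr_gt0// ltr0n.
- by rewrite exprn_gt0// expR_gt0.
- by apply: csmoothM => //; exact: openT.
split=> s.
- have /andP[a b] := chi01 s.
  by rewrite mulr_ge0//= mulr_ile1.
- rewrite derive1E.
  have -> : 'D_1 (fun s => chi s * chi s) s = chi s * 'D_1 chi s + chi s * 'D_1 chi s.
    apply: (@deriveM_at R R unit (fun _ => 1) chi chi tt s); exact: csmooth_diff schi I.
  rewrite dchi.
  have [q0|q0] := leP (q s) 0.
    by rewrite /chi /flat ltNge q0 /= !mul0r addr0 expr0n/= mulr0.
  have f2 : 0 <= flat 2 (q s) <= 4.
    rewrite flat_ge0 /=; apply: le_trans (flat_le 2 0 (ltW q0)) _.
    by rewrite addn0 expr0 mulr1 expr2 -natrM.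
  have s4 : s ^+ 2 <= 4 by move: q0; rewrite /q; lra.
  have -> : (chi s * (flat 2 (q s) * (- 2 * s)) + chi s * (flat 2 (q s) * (- 2 * s))) ^+ 2
    = (16 * (chi s * chi s)) * (flat 2 (q s) ^+ 2 * s ^+ 2) by ring.
  have -> : 16 * (16 * 4) * (chi s * chi s) = (16 * (chi s * chi s)) * (16 * 4) by ring.
  apply: ler_wpM2l.
    by case/andP: (chi01 s) => *; rewrite !mulr_ge0.
  apply: ler_pM; rewrite ?sqr_ge0//.
  by case/andP: f2 => *; nra.
- rewrite ler_norml => /andP[s1 s2].
  have q3 : 3 <= q s by rewrite /q; nra.
  have q0 : 0 < q s by apply: lt_le_trans q3.
  rewrite -expr2 ler_pXn2r ?nnegrE ?expR_ge0// ?flat_ge0//.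
  by rewrite /chi /flat q0 expr0 mul1r ler_expR lerN2 lef_pV2 ?posrE.
- move=> s2; rewrite /chi /flat ifF ?mul0r//; apply/negbTE.
  rewrite -leNgt /q subr_le0 -[leRHS]real_normK ?num_real//.
  by nra.
Qed.

End Bump.

(** * Lebesgue measure on the plane and the fundamental theorem of calculus *)

HB.instance Definition _ (R : realType) := Measure.copy (@leb2 R)
  (@lebesgue_measure R \x @lebesgue_measure R)%E.

Section PlaneMeasure.
Variable R : realType.
Implicit Types (f : R * R -> R) (U D K : set (R * R)) (M : R).
Local Notation mu := (@lebesgue_measure R).

(** The sigma-algebra is generated by rectangles, and an open set is the countable union of the
    squares with rational centre and radius 1/(k+1) that it contains. *)
Lemma open_measurable_plane U : open U -> measurable U.
Proof.
move=> oU.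
pose sq (q q' : rat) (k : nat) : set (R * R) :=
  ball (ratr q : R) k.+1%:R^-1 `*` ball (ratr q' : R) k.+1%:R^-1.
pose V q q' k := if asbool (sq q q' k `<=` U) then sq q q' k else set0.
have -> : U = \bigcup_q \bigcup_q' \bigcup_k V q q' k.
  apply/seteqP; split=> [x Ux|x [q _ [q' _ [k _]]]]; last first.
    rewrite /V; case: asboolP => [sU|_ []]; exact: sU.
  have : nbhs x U by rewrite nbhsE /=; exists U.
  rewrite -nbhs_ballE => -[/= r r0 xU].
  have [k kr] : exists k : nat, k.+1%:R^-1 < r / 2.
    have [N _ /(_ N (leqnn N))] :=
      near_infty_natSinv_lt (PosNum (divr_gt0 r0 (ltr0Sn R 1))).
    by exists N.
  have k0 : 0 < k.+1%:R^-1 :> R by rewrite invr_gt0.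
  have rat_near (t : R) : exists q : rat, `|ratr q - t| < k.+1%:R^-1.
    move: (k.+1%:R^-1 : R) k0 => e e0.
    have tt : t - e < t + e by rewrite ltrBlDr -addrA ltrDl addr_gt0.
    have [q] := rat_in_itvoo tt.
    by rewrite in_itv/= => /andP[q1 q2]; exists q; rewrite ltr_norml; lra.
  have [q qx] := rat_near x.1; have [q' qx'] := rat_near x.2.
  exists q => //; exists q' => //; exists k => //.
  rewrite /V ifT; first by split; rewrite /ball /=.
  apply/asboolP => y [/= y1 y2]; apply: xU; split; rewrite /ball /= in y1 y2 *.
  - apply: le_lt_trans (ler_distD (ratr q) _ _) _; rewrite distrC in qx.
    by apply: lt_trans (ltrD qx y1) _; rewrite (splitr r) ltrD.
  - apply: le_lt_trans (ler_distD (ratr q') _ _) _; rewrite distrC in qx'.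
    by apply: lt_trans (ltrD qx' y2) _; rewrite (splitr r) ltrD.
apply: bigcupT_measurable_rat => q; apply: bigcupT_measurable_rat => q'.
apply: bigcupT_measurable => k; rewrite /V; case: ifP => // _.
by apply: measurableX; apply: open_measurable; exact: ball_open.
Qed.

Lemma closed_measurable_plane U : closed U -> measurable U.
Proof. by move/closed_openC/open_measurable_plane/measurableC; rewrite setCK. Qed.

Lemma continuous_measurable_plane U f : open U ->
  (forall x, U x -> {for x, continuous f}) -> measurable_fun U f.
Proof.
move=> oU cf; apply: (measurability _ (RGenOInfty.measurableE R)).
move=> _ [_ [a ->] <-]; apply: open_measurable_plane.
rewrite openE => x [Ux fx]; rewrite /interior.
apply: filterI; first exact: open_nbhs_nbhs.
apply: (cf x Ux); apply: open_nbhs_nbhs; split=> //; exact: interval_open.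
Qed.

Definition box M : set (R * R) := `[- M, M]%classic `*` `[- M, M]%classic.

Lemma boxE M x : box M x <-> `|x.1| <= M /\ `|x.2| <= M.
Proof. by rewrite /box /= !in_itv/= !ler_norml. Qed.

Lemma compact_box M : compact (box M).
Proof. by apply: compact_setX; exact: segment_compact. Qed.

Lemma closed_box M : closed (box M).
Proof. by apply: compact_closed; [exact: norm_hausdorff|exact: compact_box]. Qed.

Lemma measurable_box M : measurable (box M).
Proof. by apply: measurableX; exact: measurable_itv. Qed.

Lemma leb2_box M : 0 <= M -> leb2 (box M) = ((2 * M) ^+ 2)%:E.
Proof.
move=> M0; rewrite /leb2 product_measure1E//.
have := lebesgue_measure_itv `[(- M)%R, M]%R; rewrite /= lte_fin => mE.
rewrite [X in (X * _)%E]mE [X in (_ * X)%E]mE; case: ifP => [_|].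
  by rewrite -EFinD -EFinM expr2; congr _%:E; ring.
move=> /negbT; rewrite -leNgt => M1; have -> : M = 0 by lra.
by rewrite mule0 mulr0 expr0n.
Qed.

(** [f] is bounded on the compact set [F] intersected with the box. Three sets are needed because
    [D] may be the open half-plane: continuity on [D] alone would not bound [f] near the
    boundary. *)
Lemma integrable_continuous_box U D F f M : open U -> closed F -> F `<=` U ->
  measurable D -> D `<=` F -> (forall x, U x -> {for x, continuous f}) ->
  (forall x, D x -> ~ box M x -> f x = 0) -> (@leb2 R).-integrable D (EFin \o f).
Proof.
move=> oU cF FU mD DF cf f0.
have mf : measurable_fun D f.
  apply: measurable_funS (continuous_measurable_plane oU cf) => //.
  - exact: open_measurable_plane.
  - exact: subset_trans FU.
have cFB : compact (F `&` box M).
  by rewrite setIC; apply: compact_closedI => //; exact: compact_box.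
have iDB : (@leb2 R).-integrable (D `&` box M) (EFin \o f).
  have mDB : measurable (D `&` box M) by apply: measurableI => //; exact: measurable_box.
  apply: measurable_bounded_integrable => //.
  - apply: (@le_lt_trans _ _ (leb2 (box `|M|))).
      apply: le_measure; rewrite ?inE//; first exact: measurable_box.
      move=> x [_ /boxE[x1 x2]]; apply/boxE.
      by split; [apply: le_trans x1 _|apply: le_trans x2 _]; exact: ler_norm.
    by rewrite leb2_box// ltry.
  - by apply: measurable_funS mf => //; exact: subIsetl.
  - have cfB : compact (f @` (F `&` box M)).
      apply: continuous_compact => //; apply: continuous_in_subspaceT => x.
      by rewrite inE => -[/FU/cf].
    have [N [Nr fN]] := compact_bounded cfB.
    exists N; split=> // N' NN' x [Dx Bx] /=; apply: fN => //.
    by exists x => //; split => //; exact: DF.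
have mDB : measurable (D `&` box M) by apply: measurableI => //; exact: measurable_box.
rewrite /leb2 in iDB *.
apply/(@integrable_mkcond _ _ R (mu \x mu)%E D (EFin \o f) mD).
move/(@integrable_mkcond _ _ R (mu \x mu)%E _ (EFin \o f) mDB): iDB.
congr (integrable _ _ _); apply/funext => x; rewrite !patchE in_setI.
case: (boolP (x \in D)) => //= /set_mem Dx; case: ifPn => //.
by rewrite notin_setE => /(f0 _ Dx) /= ->.
Qed.

(* Fundamental theorem of calculus on a line and on a half-line. *)
Lemma integral_derive_segment (F : R -> R) (a b : R) : a < b ->
  (forall x, a <= x <= b -> derivable F x 1) ->
  (forall x, a <= x <= b -> {for x, continuous ('D_1 F)}) ->
  (\int[mu]_(x in `[a, b]) ('D_1 F x)%:E = (F b - F a)%:E)%E.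
Proof.
move=> ab dF cF; rewrite EFinB; apply: continuous_FTC2 => //.
- by apply: continuous_in_subspaceT => x; rewrite inE/= in_itv/= => /cF.
- have cF' x : a <= x <= b -> {for x, continuous F}.
    by move=> /dF /derivable1_diffP /differentiable_continuous.
  split.
  + by move=> x; rewrite in_itv/= => /andP[/ltW ax /ltW xb]; apply: dF; rewrite ax.
  + by apply: cvg_at_right_filter; apply: cF'; rewrite lexx ltW.
  + by apply: cvg_at_left_filter; apply: cF'; rewrite lexx ltW.
- by move=> x _; rewrite derive1E.
Qed.

Lemma integral_derive_line (F : R -> R) (M : R) : 0 < M ->
  (forall x, derivable F x 1) -> continuous ('D_1 F) ->
  (forall x, M <= `|x| -> F x = 0) -> (forall x, M <= `|x| -> 'D_1 F x = 0) ->
  (\int[mu]_x ('D_1 F x)%:E = 0)%E.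
Proof.
move=> M0 dF cF F0 D0.
have -> : (\int[mu]_x ('D_1 F x)%:E = \int[mu]_(x in `[(- M)%R, M]) ('D_1 F x)%:E)%E.
  rewrite [RHS]integral_mkcond; apply: eq_integral => x _; rewrite patchE.
  case: ifPn => //; rewrite notin_setE/= in_itv/= => /negP.
  by rewrite -ler_norml -ltNge => /ltW /D0 ->.
rewrite integral_derive_segment; [|lra|by []|by move=> x _; exact: cF].
by rewrite !F0 ?subrr// ?normrN (ger0_norm (ltW M0)).
Qed.

Lemma integral_derive_half_line (F : R -> R) (M : R) : 0 < M ->
  (forall x, 0 <= x -> derivable F x 1) ->
  (forall x, 0 <= x -> {for x, continuous ('D_1 F)}) ->
  (forall x, M <= x -> F x = 0) -> (forall x, M <= x -> 'D_1 F x = 0) ->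
  (\int[mu]_(x in `]0%R, +oo[) ('D_1 F x)%:E = (- F 0)%:E)%E.
Proof.
move=> M0 dF cF F0 D0.
have -> : (\int[mu]_(x in `]0%R, +oo[) ('D_1 F x)%:E =
           \int[mu]_(x in `]0%R, M]) ('D_1 F x)%:E)%E.
  rewrite integral_mkcond [RHS]integral_mkcond; apply: eq_integral => x _.
  rewrite !patchE; case: ifPn => [|]; rewrite !(inE, notin_setE)/= !in_itv/= ?andbT.
    move=> x0; case: ifPn => //; rewrite notin_setE/= in_itv/= x0/= => /negP.
    by rewrite -ltNge => /ltW /D0 ->.
  by move=> /negP x0; rewrite ifF//; apply: memNset; rewrite /= in_itv/= (negbTE x0).
(* The endpoint 0 is a null set: the integral is taken on the open half-line, while the fundamental
   theorem is applied on a closed segment. *)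
rewrite integral_itv_obnd_cbnd; last first.
  apply/measurable_EFinP; apply: (@measurable_funS _ _ _ _ `[0, M]%classic) => //.
    by apply: subset_itvr; rewrite bnd_simp.
  apply: subspace_continuous_measurable_fun => //.
  apply: continuous_in_subspaceT => x; rewrite inE/= in_itv/= => /andP[x0 _].
  exact: cF.
rewrite integral_derive_segment//; first by rewrite F0// sub0r.
- by move=> x /andP[x0 _]; exact: dF.
- by move=> x /andP[x0 _]; exact: cF.
Qed.

End PlaneMeasure.

(** * Divergence theorem in the half-plane, by slices and Fubini *)

Section HalfPlaneDivergence.
Variable R : realType.
Implicit Types (f : R * R -> R) (U : set (R * R)) (M : R).
Local Notation mu := (@lebesgue_measure R).

Let quotient1 f (y t : R) :
  (fun h : R => h^-1 *: ((f \o shift (t, y)) (h *: e1 R) - f (t, y))) =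
  (fun h : R => h^-1 *: (((fun s => f (s, y)) \o shift t) (h *: 1) - f (t, y))).
Proof.
apply/funext => h /=; congr (_ *: (f _ - _)).
by apply/pair_equal_spec; split; rewrite /= /GRing.scale/= ?mulr0 ?add0r.
Qed.

Let quotient2 f (x t : R) :
  (fun h : R => h^-1 *: ((f \o shift (x, t)) (h *: e2 R) - f (x, t))) =
  (fun h : R => h^-1 *: (((fun s => f (x, s)) \o shift t) (h *: 1) - f (x, t))).
Proof.
apply/funext => h /=; congr (_ *: (f _ - _)).
by apply/pair_equal_spec; split; rewrite /= /GRing.scale/= ?mulr0 ?add0r.
Qed.

Lemma derive_slice1 f (y t : R) :
  'D_(e1 R) f (t, y) = 'D_1 (fun s => f (s, y)) t.
Proof. by rewrite /derive quotient1. Qed.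

Lemma derive_slice2 f (x t : R) :
  'D_(e2 R) f (x, t) = 'D_1 (fun s => f (x, s)) t.
Proof. by rewrite /derive quotient2. Qed.

Lemma derivable_slice1 f (y t : R) :
  differentiable f (t, y) -> derivable (fun s => f (s, y)) t 1.
Proof.
by move=> /diff_derivable - /(_ (e1 R)); rewrite /derivable quotient1.
Qed.

Lemma derivable_slice2 f (x t : R) :
  differentiable f (x, t) -> derivable (fun s => f (x, s)) t 1.
Proof.
by move=> /diff_derivable - /(_ (e2 R)); rewrite /derivable quotient2.
Qed.

Lemma continuous_slice1 f (y t : R) : {for (t, y), continuous f} ->
  {for t, continuous (fun s => f (s, y))}.
Proof.
move=> cf; apply: (@continuous_comp _ _ _ (fun s : R => (s, y)) f) => //.
exact: (@cvg_pair _ _ _ (nbhs t) (nbhs t) (nbhs y) _ _ _ id (cst y) cvg_id (cvg_cst _)).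
Qed.

Lemma continuous_slice2 f (x t : R) : {for (x, t), continuous f} ->
  {for t, continuous (fun s => f (x, s))}.
Proof.
move=> cf; apply: (@continuous_comp _ _ _ (fun s : R => (x, s)) f) => //.
exact: (@cvg_pair _ _ _ (nbhs t) (nbhs x) (nbhs t) _ _ _ (cst x) id (cvg_cst _) cvg_id).
Qed.

Lemma derive_outside_closed f (K : set (R * R)) v x : closed K ->
  (forall y, ~ K y -> f y = 0) -> ~ K x -> 'D_v f x = 0.
Proof.
move=> cK f0 Kx; rewrite (@near_eq_derive _ _ _ f (cst 0)) ?derive_cst//.
by apply: (near_open_eq (closed_openC cK)) => // y /f0.
Qed.

Lemma closed_cl_half : closed (@cl_half R).
Proof.
rewrite (_ : @cl_half R = snd @^-1` [set t : R | 0 <= t]); last by [].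
by apply: closed_comp; [move=> x _; exact: cvg_snd|exact: closed_ge].
Qed.

Lemma open_op_half : open (@op_half R).
Proof.
rewrite (_ : @op_half R = snd @^-1` [set t : R | 0 < t]); last by [].
by apply: open_comp; [move=> x _; exact: cvg_snd|exact: open_gt].
Qed.

Lemma op_half_cl : @op_half R `<=` @cl_half R.
Proof. by move=> x /ltW. Qed.

Lemma measurable_op_half : measurable (@op_half R).
Proof. by apply: open_measurable_plane; exact: open_op_half. Qed.

Lemma csmooth_continuous U f x : csmooth (@axis R) U f -> U x -> {for x, continuous f}.
Proof. by move=> sf Ux; apply: differentiable_continuous; exact: csmooth_diff sf Ux. Qed.

Lemma integrable_op_half U f M : open U -> @cl_half R `<=` U ->
  csmooth (@axis R) U f -> (forall x, ~ box M x -> f x = 0) ->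
  (@leb2 R).-integrable (@op_half R) (EFin \o f).
Proof.
move=> oU HU sf f0; apply: (@integrable_continuous_box _ U _ (@cl_half R) _ M) => //.
- exact: closed_cl_half.
- exact: measurable_op_half.
- exact: op_half_cl.
- by move=> x; exact: csmooth_continuous.
- by move=> x _; exact: f0.
Qed.

Let off_box1 f M (s y : R) : (forall x, ~ box M x -> f x = 0) ->
  `|M| + 1 <= `|s| -> f (s, y) = 0.
Proof.
move=> f0 sM; apply: f0 => /boxE[/= sM' _]; have := ler_norm M; lra.
Qed.

Let off_box2 f M (x s : R) : (forall x, ~ box M x -> f x = 0) ->
  `|M| + 1 <= s -> f (x, s) = 0.
Proof.
move=> f0 sM; apply: f0 => /boxE[/= _ sM'].
have := ler_norm M; have := ler_norm s; lra.
Qed.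

(** Each horizontal slice is the derivative of a compactly supported function on the line. *)
Lemma integral_op_half_derive1 U f M : open U -> @cl_half R `<=` U ->
  csmooth (@axis R) U f -> (forall x, ~ box M x -> f x = 0) ->
  (\int[@leb2 R]_(x in @op_half R) ('D_(e1 R) f x)%:E = 0)%E.
Proof.
move=> oU HU sf f0.
have sD : csmooth (@axis R) U ('D_(e1 R) f) := csmooth_derive false sf.
have D0 x : ~ box M x -> 'D_(e1 R) f x = 0 by exact/derive_outside_closed/f0/closed_box.
have := integrable_op_half oU HU sD D0; rewrite /leb2.
move=> /(@integrable_mkcond _ _ R (mu \x mu)%E _ _ measurable_op_half) iD.
rewrite integral_mkcond -integral21_prod_meas1//.
apply: integral0_eq => y _; rewrite /fubini_G.
have [y0|y0] := ltP 0 y; last first.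
  apply: integral0_eq => x _; rewrite patchE memNset// /op_half/=.
  by apply/negP; rewrite -leNgt.
rewrite -[RHS](@integral_derive_line _ (fun s => f (s, y)) (`|M| + 1)).
- by apply: eq_integral => x _; rewrite patchE mem_set//= derive_slice1.
- by rewrite ltr_wpDl.
- by move=> s; apply: derivable_slice1; apply: csmooth_diff sf _; apply: HU; exact: ltW.
- move=> s; rewrite (_ : 'D_(1 : R) _ = fun s => 'D_(e1 R) f (s, y)); last first.
    by apply/funext => t; rewrite derive_slice1.
  apply: (@continuous_slice1 ('D_(e1 R) f) y s); apply: csmooth_continuous sD _; apply: HU; exact: ltW.
- by move=> s; exact: off_box1.
- by move=> s sM; rewrite -derive_slice1; exact: off_box1 D0 sM.
Qed.

(** Each vertical slice integrates to minus its boundary value; smoothness on a neighbourhood of the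
    closed half-plane makes the slices differentiable at 0. *)
Lemma integral_op_half_derive2 U f M : open U -> @cl_half R `<=` U ->
  csmooth (@axis R) U f -> (forall x, ~ box M x -> f x = 0) ->
  (\int[@leb2 R]_(x in @op_half R) ('D_(e2 R) f x)%:E = \int[mu]_s (- f (s, 0))%:E)%E.
Proof.
move=> oU HU sf f0.
have sD : csmooth (@axis R) U ('D_(e2 R) f) := csmooth_derive true sf.
have D0 x : ~ box M x -> 'D_(e2 R) f x = 0 by exact/derive_outside_closed/f0/closed_box.
have := integrable_op_half oU HU sD D0; rewrite /leb2.
move=> /(@integrable_mkcond _ _ R (mu \x mu)%E _ _ measurable_op_half) iD.
rewrite integral_mkcond -integral12_prod_meas1//.
apply: eq_integral => x _; rewrite /fubini_F.
rewrite -[RHS](@integral_derive_half_line _ (fun s => f (x, s)) (`|M| + 1)).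
- rewrite [RHS]integral_mkcond; apply: eq_integral => y _; rewrite !patchE.
  rewrite (_ : (y \in _) = ((x, y) \in @op_half R)) ?derive_slice2//.
  by apply/idP/idP; rewrite !inE/= in_itv/= andbT.
- by rewrite ltr_wpDl.
- by move=> s s0; apply: derivable_slice2; apply: csmooth_diff sf _; exact: HU.
- move=> s s0; rewrite (_ : 'D_(1 : R) _ = fun s => 'D_(e2 R) f (x, s)); last first.
    by apply/funext => t; rewrite derive_slice2.
  by apply: (@continuous_slice2 ('D_(e2 R) f) x s); apply: csmooth_continuous sD _; exact: HU.
- by move=> s; exact: off_box2.
- by move=> s sM; rewrite -derive_slice2; exact: off_box2 D0 sM.
Qed.

End HalfPlaneDivergence.

Section NonnegativeIntegral.
Context d (T : measurableType d) (R : realType) (mu : {measure set T -> \bar R}).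
Local Open Scope ereal_scope.

Lemma ge0_integral_subU (A B E : set T) (f : T -> \bar R) : measurable A ->
  measurable B -> measurable E -> measurable_fun (B `|` E) f ->
  (forall x, 0 <= f x) -> A `<=` B `|` E ->
  \int[mu]_(x in A) f x <= \int[mu]_(x in B) f x + \int[mu]_(x in E) f x.
Proof.
move=> mA mB mE mf f0 ABE.
apply: (@le_trans _ _ (\int[mu]_(x in B `|` E) f x)).
  by apply: ge0_subset_integral => //; exact: measurableU.
have BE : B `|` E = B `|` (E `\` B) by rewrite setUDr setDv setD0.
rewrite [in leLHS]BE ge0_integral_setU//; [|exact: measurableD|by rewrite -BE|].
  rewrite leeD2l//; apply: ge0_subset_integral => //; first exact: measurableD.
  by apply: measurable_funS mf; [exact: measurableU|exact: subsetUr].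
by rewrite disj_set2E; apply/eqP/seteqP; split=> x //= [? [_]]; exact.
Qed.

End NonnegativeIntegral.

(** * Logarithmic shells and the integral of 1/|x|^2 over them *)

Section Shells.
Variable R : realType.
Implicit Types (x : R * R) (a b : R).

(** The square of the Euclidean norm is used because it is a polynomial, hence smooth at the
    origin. *)
Definition rho x : R := x.1 ^+ 2 + x.2 ^+ 2.

(** An annulus in the scale ln |x|^2; it never contains the origin. *)
Definition shell a b : set (R * R) := [set x | expR a <= rho x <= expR b].

Lemma rho_ge0 x : 0 <= rho x.
Proof. by rewrite addr_ge0// sqr_ge0. Qed.

Lemma rho_gt0 x : (0 < rho x) = (x != (0, 0)).
Proof.
case: x => s t; rewrite /rho lt_neqAle rho_ge0 andbT eq_sym paddr_eq0 ?sqr_ge0//.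
by rewrite !sqrf_eq0.
Qed.

Lemma csmooth_rho (U : set (R * R)) : open U -> csmooth (@axis R) U rho.
Proof.
move=> oU; rewrite (_ : rho = fun x => x.1 * x.1 + x.2 * x.2); last first.
  by apply/funext => x; rewrite /rho !expr2.
by apply: csmoothD => //; apply: csmoothM => //;
  [exact: csmooth_fst|exact: csmooth_fst|exact: csmooth_snd|exact: csmooth_snd].
Qed.

Lemma continuous_rho : continuous rho.
Proof.
move=> x; apply: differentiable_continuous.
exact: csmooth_diff (csmooth_rho openT) I.
Qed.

Lemma shell_gt0 a b x : shell a b x -> 0 < rho x.
Proof. by move=> /andP[+ _]; apply: lt_le_trans; exact: expR_gt0. Qed.

Lemma closed_shell a b : closed (shell a b).
Proof.
rewrite (_ : shell a b = rho @^-1` `[expR a, expR b]%classic).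
  by apply: closed_comp; [move=> x _; exact: continuous_rho|exact: interval_closed].
by apply/seteqP; split=> x; rewrite /shell /= in_itv.
Qed.

Lemma measurable_shell a b : measurable (shell a b).
Proof. by apply: closed_measurable_plane; exact: closed_shell. Qed.

Lemma sqr_le_expR (t b : R) : t ^+ 2 <= expR b -> `|t| <= expR (b / 2).
Proof.
move=> tb; rewrite -(@ler_pXn2r _ 2)// ?nnegrE ?expR_ge0//.
by rewrite real_normK ?num_real// -expRM_natl mulrC divfK// pnatr_eq0.
Qed.

Lemma rho_le_box b x : rho x <= expR b -> box (expR (b / 2)) x.
Proof.
move=> xb; apply/boxE; split; apply: sqr_le_expR; apply: le_trans xb;
  by rewrite /rho ?lerDl ?lerDr sqr_ge0.
Qed.

Lemma shell_box a b : shell a b `<=` box (expR (b / 2)).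
Proof. by move=> x /andP[_]; exact: rho_le_box. Qed.

Lemma open_rho_gt0 : open [set x | 0 < rho x].
Proof.
rewrite (_ : [set x | _] = rho @^-1` [set t | 0 < t])//.
by apply: open_comp; [move=> x _; exact: continuous_rho|exact: open_gt].
Qed.

Lemma csmooth_inv_rho : csmooth (@axis R) [set x | 0 < rho x] (fun x => (rho x)^-1).
Proof.
apply: (csmooth_comp open_rho_gt0 (@smooth1_inv R)) => //.
exact: csmooth_rho open_rho_gt0.
Qed.

Lemma integrable_inv_rho a b (D : set (R * R)) : measurable D ->
  (@leb2 R).-integrable (D `&` shell a b) (EFin \o (fun x => (rho x)^-1)).
Proof.
move=> mD; have mDS : measurable (D `&` shell a b).
  by apply: measurableI => //; exact: measurable_shell.
apply: (integrable_continuous_box (M := expR (b / 2)) open_rho_gt0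
  (@closed_shell a b)) => //.
- by move=> x; exact: shell_gt0.
- by move=> x; exact: csmooth_continuous csmooth_inv_rho.
- by move=> x [_ /shell_box Bx] /(_ Bx).
Qed.

Lemma measurable_inv_rho a b :
  measurable_fun (shell a b) (fun x => ((rho x)^-1)%:E).
Proof.
have := integrable_inv_rho a b measurableT; rewrite setTI.
by move/measurable_int.
Qed.

(* A shell of logarithmic width 1 lies in a square of comparable area,
   so polar coordinates are not needed. *)
Lemma integral_inv_rho_shell a (N : nat) :
  (\int[@leb2 R]_(x in shell a (a + N%:R)) ((rho x)^-1)%:E
     <= (4 * expR 1 * N.+1%:R)%:E)%E.
Proof.
have shellS b c : (\int[@leb2 R]_(x in shell b c) ((rho x)^-1)%:E
    <= (expR (- b) * (4 * expR c))%:E)%E.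
  have -> : 4 * expR c = (2 * expR (c / 2)) ^+ 2.
    by rewrite exprMn -expRM_natl mulrC [2 * _]mulrC divfK ?pnatr_eq0//; ring.
  rewrite EFinM -leb2_box ?expR_ge0//.
  apply: (@le_trans _ _ (\int[@leb2 R]_(x in shell b c) (cst (expR (- b))%:E x))%E).
    apply: ge0_le_integral => //.
    - exact: measurable_shell.
    - by move=> x _; rewrite lee_fin invr_ge0 rho_ge0.
    - exact: measurable_inv_rho.
    - move=> x /[dup] /shell_gt0 x0 /andP[bx _]; rewrite lee_fin expRN.
      by rewrite lef_pV2 ?posrE// expR_gt0.
  rewrite integral_cst//; last exact: measurable_shell.
  apply: lee_wpmul2l; first by rewrite lee_fin expR_ge0.
  apply: le_measure; rewrite ?inE; [exact: measurable_shell|exact: measurable_box|].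
  exact: shell_box.
have expS (b c : R) : (expR (- b) * (4 * expR c))%:E = (4 * expR (c - b))%:E.
  by rewrite expRD; congr _%:E; ring.
elim: N => [|N IH].
  apply: le_trans (shellS _ _) _; rewrite expS lee_fin addr0 subrr expR0 mulr1.
  by rewrite mulr1 ler_pMr// -expR0 ler_expR.
have mS b c : measurable (shell b c) := @measurable_shell b c.
apply: (@le_trans _ _ (\int[@leb2 R]_(x in shell a (a + N%:R)) ((rho x)^-1)%:E +
    \int[@leb2 R]_(x in shell (a + N%:R) (a + N.+1%:R)) ((rho x)^-1)%:E)%E).
  apply: ge0_integral_subU; [exact: mS|exact: mS|exact: mS| |by move=> x; rewrite lee_fin invr_ge0 rho_ge0|].
    apply: measurable_funS (@measurable_inv_rho a (a + N.+1%:R)); first exact: mS.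
    move=> x [/andP[ax xN]|/andP[ax xN]]; apply/andP; split=> //.
    - by apply: le_trans xN _; rewrite ler_expR lerD2l ler_nat.
    - by apply: le_trans ax; rewrite ler_expR lerDl.
  move=> x /andP[ax xN].
  have [xa|xa] := leP (rho x) (expR (a + N%:R)); first by left; apply/andP.
  by right; apply/andP; split=> //; exact: ltW.
have -> : (4 * expR 1 * N.+2%:R = 4 * expR 1 * N.+1%:R + 4 * expR 1 :> R).
  by rewrite -[N.+2]addn1 natrD; ring.
rewrite EFinD leeD//.
apply: le_trans (shellS _ _) _; rewrite expS lee_fin.
by rewrite (_ : a + N.+1%:R - (a + N%:R) = 1)// -natr1; ring.
Qed.

End Shells.

(** * Abstract criterion: lower bounds on the index from shell energies *)

Section IndexCriterion.
Variables (R : realType) (D : set (R * R)) (w : R * R -> R).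
Hypothesis mD : measurable D.
Hypothesis w_ge0 : forall x, 0 <= w x.
Hypothesis w_gt0 : forall x, D x -> 0 < rho x -> 0 < w x.
Hypothesis iw : forall M, (@leb2 R).-integrable (D `&` box M) (EFin \o w).
Hypothesis unit_square : `[2^-1, 1]%classic `*` `[2^-1, 1]%classic `<=` D.
Variables (C c0 : R).
Hypothesis C_ge0 : 0 <= C.
Hypothesis c0_gt0 : 0 < c0.
Local Notation mu := (@leb2 R).
Implicit Types (c : R) (n : nat).

Definition inv_rho (x : R * R) : R := (rho x)^-1.

Definition outer_shell c n : set (R * R) := shell (c - n%:R *+ 2) (c + n%:R *+ 2).
Definition inner_shell c n : set (R * R) := shell (c - n%:R) (c + n%:R).

(** Up to the factor [kap n], this bounds from above the integrand of the quadratic form on one test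
    function; [energy] is its integral. *)
Definition density c n x : R :=
  C / n%:R ^+ 2 * (inv_rho \_ (outer_shell c n)) x - c0 * (w \_ (inner_shell c n)) x.

Definition energy c n : R :=
  C / n%:R ^+ 2 * \int[mu]_(x in D `&` outer_shell c n) inv_rho x
  - c0 * \int[mu]_(x in D `&` inner_shell c n) w x.

Let mDs a b : measurable (D `&` shell a b).
Proof. by apply: measurableI => //; exact: measurable_shell. Qed.

Lemma integrable_weight_shell a b : mu.-integrable (D `&` shell a b) (EFin \o w).
Proof.
apply: (integrableS _ _ _ (iw (expR (b / 2)))) => //.
- by apply: measurableI => //; exact: measurable_box.
- exact: mDs.
- by move=> x [Dx /shell_box].
Qed.

Let integrable_patch (f : R * R -> R) a b :
  mu.-integrable (D `&` shell a b) (EFin \o f) ->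
  mu.-integrable D (EFin \o (f \_ (shell a b))).
Proof.
move=> /(@integrable_mkcond _ _ R mu _ _ (mDs a b)) h.
apply/(@integrable_mkcond _ _ R mu _ _ mD); move: h.
by rewrite patch_setI restrict_EFin.
Qed.

Lemma integrable_density c n : mu.-integrable D (EFin \o density c n).
Proof.
have i1 := integrableZl (mu := mu) mD (C / n%:R ^+ 2)
  (integrable_patch (integrable_inv_rho (c - n%:R *+ 2) (c + n%:R *+ 2) mD)).
have i2 := integrableZl (mu := mu) mD c0
  (integrable_patch (integrable_weight_shell (c - n%:R) (c + n%:R))).
exact: (integrableB (mu := mu) mD i1 i2).
Qed.

Lemma integral_density c n : (\int[mu]_(x in D) (density c n x)%:E = (energy c n)%:E)%E.
Proof.
rewrite -[LHS]fineK; last exact: (integrable_fin_num (mu := mu) mD (integrable_density c n)).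
congr _%:E; rewrite -/(Rintegral mu D (density c n)) /density.
have iI : mu.-integrable D (EFin \o (inv_rho \_ (outer_shell c n))).
  exact/integrable_patch/integrable_inv_rho.
have iW : mu.-integrable D (EFin \o (w \_ (inner_shell c n))).
  exact/integrable_patch/integrable_weight_shell.
rewrite RintegralB//; last 2 first.
- exact: (integrableZl (mu := mu) mD (C / n%:R ^+ 2) iI).
- exact: (integrableZl (mu := mu) mD c0 iW).
by rewrite !RintegralZl// -!Rintegral_mkcondr.
Qed.

Lemma integral_inv_rho_outer c n : (0 < n)%N ->
  \int[mu]_(x in D `&` outer_shell c n) inv_rho x <= 20 * expR 1 * n%:R.
Proof.
move=> n0; have /fineK E := integrable_fin_num (mu := mu) (mDs _ _)
  (integrable_inv_rho (c - n%:R *+ 2) (c + n%:R *+ 2) mD).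
rewrite -lee_fin /Rintegral E.
apply: (@le_trans _ _ (\int[mu]_(x in outer_shell c n) (inv_rho x)%:E)%E).
  apply: ge0_subset_integral => //; [exact: mDs|exact: measurable_shell| |].
  - exact: measurable_inv_rho.
  - by move=> x _; rewrite lee_fin invr_ge0 rho_ge0.
rewrite /outer_shell (_ : c + n%:R *+ 2 = c - n%:R *+ 2 + (4 * n)%:R); last first.
  by rewrite natrM; ring.
apply: le_trans (integral_inv_rho_shell _ _) _; rewrite lee_fin.
(* The outer shell has logarithmic width 4n, so the shell bound is 4 e (4n + 1), at most 4 e (5n) as
   n >= 1. *)
rewrite (_ : 20 * expR 1 * n%:R = 4 * expR 1 * (5 * n)%:R); last first.
  by rewrite natrM; ring.
rewrite ler_wpM2l ?mulr_ge0 ?expR_ge0// ler_nat.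
by rewrite -add1n [(5 * n)%N]mulSn leq_add2r.
Qed.

Lemma energy_le c n : (0 < n)%N ->
  energy c n <= 20 * expR 1 * C / n%:R - c0 * \int[mu]_(x in D `&` inner_shell c n) w x.
Proof.
move=> n0; rewrite lerD2r.
have n0' : 0 < n%:R :> R by rewrite ltr0n.
apply: (@le_trans _ _ (C / n%:R ^+ 2 * (20 * expR 1 * n%:R))).
  by rewrite ler_wpM2l ?integral_inv_rho_outer// divr_ge0// exprn_ge0.
rewrite le_eqVlt; apply/orP; left; apply/eqP; field.
by rewrite gt_eqF.
Qed.

(** Otherwise w would vanish almost everywhere on the shell. But the square [1/2, 1]^2, of area 1/4,
    lies in [D] and has 1/2 <= rho <= 2, hence lies in the shell, and w is positive on it. *)
Lemma integral_weight_unit_shell : 0 < \int[mu]_(x in D `&` inner_shell 0 1) w x.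
Proof.
set A := D `&` _.
have mA : measurable A := mDs _ _.
have iA : mu.-integrable A (EFin \o w) := integrable_weight_shell _ _.
rewrite lt_neqAle Rintegral_ge0 ?andbT; last by move=> x _; exact: w_ge0.
apply/eqP => A0.
have : (\int[mu]_(x in A) `|(w x)%:E| = 0)%E.
  under eq_integral do rewrite gee0_abs ?lee_fin ?w_ge0//.
  by rewrite -[LHS]fineK ?(integrable_fin_num (mu := mu) mA iA)// -/(Rintegral mu A w) -A0.
have mw := measurable_int mu iA.
move/(ae_eq_integral_abs mu mA mw) => [N [mN N0 AN]].
set S : set (R * R) := `[2^-1, 1]%classic `*` `[2^-1, 1]%classic.
have SA : S `<=` A.
  move=> [s t] st; split; first exact: unit_square.
  move: st; rewrite /S /inner_shell /shell /rho /= !in_itv/= sub0r add0r.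
  move=> [/andP[s1 s2] /andP[t1 t2]].
  have e2 : 2 <= expR 1 :> R by have := expR_ge1Dx (1 : R); lra.
  rewrite expRN; apply/andP; split; last by nra.
  apply: (@le_trans _ _ 2^-1); first by rewrite lef_pV2 ?posrE ?expR_gt0.
  by nra.
have SN : S `<=` N.
  move=> x Sx; apply: AN => /= /(_ (SA _ Sx)) [wx].
  have [Dx /shell_gt0 x0] := SA _ Sx.
  by have := w_gt0 Dx x0; rewrite wx ltxx.
have : (mu S <= 0)%E.
  by rewrite -N0; apply: le_measure; rewrite ?inE//; apply: measurableX.
rewrite /leb2 product_measure1E//.
have := lebesgue_measure_itv `[(2^-1)%R, 1%R : R]; rewrite /= lte_fin => mE.
rewrite [X in (X * _)%E]mE [X in (_ * X)%E]mE ifT; last by lra.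
by rewrite -EFinD -EFinM lee_fin; lra.
Qed.

Variables (test : (R * R -> R) -> Prop) (Q : (R * R -> R) -> \bar R).
Variables (family : R -> nat -> R * R -> R) (kap : nat -> R).
Hypothesis kap_gt0 : forall n, (0 < n)%N -> 0 < kap n.

Lemma integrable_density_sum k (c : 'I_k -> R) (n : 'I_k -> nat) (a : 'I_k -> R) :
  mu.-integrable D
    (fun x => (\sum_(i < k) a i ^+ 2 * (kap (n i) * density (c i) (n i) x))%R%:E).
Proof.
under eq_fun do rewrite -sumEFin.
apply: integrable_sum => // i _.
apply: (integrableZl (mu := mu) mD (a i ^+ 2)
  (f := fun x => (kap (n i) * density (c i) (n i) x)%:E)).
exact: (integrableZl (mu := mu) mD (kap (n i)) (integrable_density (c i) (n i))).
Qed.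

Hypothesis test_family : forall c n, (0 < n)%N -> test (family c n).
(** The only information on [Q] that the criterion receives: on test functions attached to disjoint
    outer shells it is dominated by a diagonal form. *)
Hypothesis Q_family : forall k (c : 'I_k -> R) (n : 'I_k -> nat) (a : 'I_k -> R),
  (forall i, (0 < n i)%N) ->
  (forall i j x, outer_shell (c i) (n i) x -> outer_shell (c j) (n j) x -> i = j) ->
  (Q (fun x => (\sum_(i < k) a i * family (c i) (n i) x)%R)
     <= \int[mu]_(x in D) (\sum_(i < k) a i ^+ 2 * (kap (n i) * density (c i) (n i) x))%R%:E)%E.

(** The dominating diagonal form has the entries [kap (n i) * energy (c i) (n i)], all negative, so
    it is negative definite. *)
Lemma neg_subspace_of_energy k (c : 'I_k -> R) (n : 'I_k -> nat) :
  (forall i, (0 < n i)%N) ->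
  (forall i j x, outer_shell (c i) (n i) x -> outer_shell (c j) (n j) x -> i = j) ->
  (forall i, test (family (c i) (n i))) ->
  (forall i, energy (c i) (n i) < 0) -> neg_subspace_dim test Q k.
Proof.
move=> n0 disj tst E0; exists (fun i => family (c i) (n i)); split=> // a a0.
apply: le_lt_trans (@Q_family k c n a n0 disj) _.
under eq_integral do rewrite -sumEFin.
rewrite integral_sum//; last first.
  move=> i; apply: (integrableZl (mu := mu) mD (a i ^+ 2) (f := fun x => (kap (n i) * density (c i) (n i) x)%:E)).
  exact: (integrableZl (mu := mu) mD (kap (n i)) (integrable_density (c i) (n i))).
have EI i : (\int[mu]_(x in D) (a i ^+ 2 * (kap (n i) * density (c i) (n i) x))%:E
    = (a i ^+ 2 * (kap (n i) * energy (c i) (n i)))%:E)%E.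
  under eq_integral do rewrite mulrA EFinM.
  rewrite integralZl//; last exact: integrable_density.
  by rewrite integral_density -EFinM mulrA.
under eq_bigr do rewrite EI.
rewrite sumEFin lte_fin.
have [i ai] : exists i, a i != 0.
  apply: contrapT => all0; apply: a0; apply/funext => i.
  by apply/eqP; apply: contrapT => /negP ai; apply: all0; exists i.
have le0 j : a j ^+ 2 * (kap (n j) * energy (c j) (n j)) <= 0.
  by rewrite mulr_ge0_le0 ?sqr_ge0// mulr_ge0_le0 ?ltW// kap_gt0.
rewrite (bigD1 i)//=; apply: (@lt_le_trans _ _ (0 + 0)); last by rewrite addr0.
apply: ltr_leD; last by apply: sumr_le0 => j _.
by rewrite pmulr_rlt0 ?exprn_even_gt0// pmulr_rlt0// kap_gt0.
Qed.

Lemma index_ge1 : (1%:E <= morse_index test Q)%E.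
Proof.
(* For n > K the gradient term 20 e C / n is smaller than [c0] times the mass of the unit shell,
   which every [inner_shell 0 n] contains. *)
pose K := 20 * expR 1 * C / (c0 * \int[mu]_(x in D `&` inner_shell 0 1) w x).
have W0 := integral_weight_unit_shell.
have cW0 : 0 < c0 * \int[mu]_(x in D `&` inner_shell 0 1) w x by rewrite mulr_gt0.
have K0 : 0 <= K by rewrite divr_ge0 ?(ltW cW0)// !mulr_ge0// expR_ge0.
pose n := Num.bound K.
have Kn : K < n%:R := archi_boundP K0.
have n0 : (0 < n)%N by rewrite -(ltr_nat R); apply: le_lt_trans K0 Kn.
apply: ereal_sup_ubound; exists 1%N => //.
apply: (@neg_subspace_of_energy 1 (fun _ => 0) (fun _ => n)) => //.
- by move=> i j x _ _; rewrite !ord1.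
- by move=> _; exact: test_family.
- move=> _; apply: le_lt_trans (energy_le _ n0) _.
  rewrite subr_lt0; apply: (@lt_le_trans _ _
    (c0 * \int[mu]_(x in D `&` inner_shell 0 1) w x)).
    by rewrite ltr_pdivrMr ?ltr0n// -ltr_pdivrMl// mulrC.
  rewrite ler_pM2l//; apply: fine_le.
  + exact: (integrable_fin_num (mu := mu) (mDs _ _) (integrable_weight_shell _ _)).
  + exact: (integrable_fin_num (mu := mu) (mDs _ _) (integrable_weight_shell _ _)).
  + apply: ge0_subset_integral; [exact: mDs|exact: mDs| | |].
    * exact: measurable_int (integrable_weight_shell _ _).
    * by move=> x _; rewrite lee_fin w_ge0.
    * move=> x [Dx /andP[x1 x2]]; split=> //; apply/andP; split.
        by apply: le_trans x1; rewrite ler_expR lerD2l lerN2 ler1n.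
      by apply: le_trans x2 _; rewrite ler_expR lerD2l ler1n.
Qed.

(** In the variable ln rho the inner shell is [2^(j+1), 2^(j+2)] and the outer one is
    [2^j, 5 * 2^j]. So inner shells of consecutive indices are adjacent, and shell [m] is exactly
    what must be added to [disk m] to get [disk m.+1]. *)
Let center j : R := (3 * 2 ^ j)%:R.
Let width j : nat := (2 ^ j)%N.

Let disk m : set (R * R) := D `&` [set x | rho x <= expR (2 ^ m.+1)%:R].

Let measurable_disk m : measurable (disk m).
Proof.
apply: measurableI => //; apply: closed_measurable_plane.
rewrite (_ : [set x | _] = @rho R @^-1` [set t | t <= expR (2 ^ m.+1)%:R])//.
by apply: closed_comp; [move=> x _; exact: continuous_rho|exact: closed_le].
Qed.

Let integrable_disk m : mu.-integrable (disk m) (EFin \o w).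
Proof.
apply: (integrableS _ _ _ (iw (expR ((2 ^ m.+1)%:R / 2)))).
- by apply: measurableI => //; exact: measurable_box.
- exact: measurable_disk.
- by move=> x [Dx /rho_le_box].
Qed.

Let disk_step m : \int[mu]_(x in disk m.+1) w x <=
  \int[mu]_(x in disk m) w x
  + \int[mu]_(x in D `&` inner_shell (center m) (width m)) w x.
Proof.
have i1 := integrable_disk m.
have i2 := integrable_weight_shell (center m - (width m)%:R) (center m + (width m)%:R).
rewrite /Rintegral -fineD; [|exact: (integrable_fin_num (mu := mu) (measurable_disk _) i1)
  |exact: (integrable_fin_num (mu := mu) (mDs _ _) i2)].
apply: fine_le.
- exact: (integrable_fin_num (mu := mu) (measurable_disk _) (integrable_disk _)).
- rewrite fin_numD; apply/andP; split;
    [exact: (integrable_fin_num (mu := mu) (measurable_disk _) i1)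
    |exact: (integrable_fin_num (mu := mu) (mDs _ _) i2)].
have sub : disk m.+1 `<=` disk m `|` (D `&` inner_shell (center m) (width m)).
  move=> x [Dx xm]; have [xm'|xm'] := leP (rho x) (expR (2 ^ m.+1)%:R).
    by left.
  right; split=> //; rewrite /inner_shell /center /width; apply/andP; split.
    apply: le_trans (ltW xm'); rewrite ler_expR -natrB; last by rewrite leq_pmull.
    by rewrite ler_nat expnS mulSn addKn.
  by apply: le_trans xm _; rewrite ler_expR -natrD ler_nat -mulSnr !expnS mulnA.
apply: (@ge0_integral_subU _ _ R mu _ _ _ (EFin \o w));
  [exact: measurable_disk|exact: measurable_disk|exact: mDs| | |exact: sub].
- apply/measurable_funU; [exact: measurable_disk|exact: mDs|].
  by split; [exact: measurable_int i1|exact: measurable_int i2].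
- by move=> x; rewrite lee_fin w_ge0.
Qed.

(** If all energies from [J] on were nonnegative, shell [j] would have mass at most K / 2^j. The
    masses of the disks would then stay bounded, whereas by monotone convergence they tend to the
    total mass. *)
Lemma frequently_negative_energy : (\int[mu]_(x in D) (w x)%:E = +oo)%E ->
  forall J, exists2 j, (J <= j)%N & energy (center j) (width j) < 0.
Proof.
move=> winf J; apply: contrapT => noj.
have Ej j : (J <= j)%N -> 0 <= energy (center j) (width j).
  by move=> Jj; rewrite leNgt; apply/negP => jneg; apply: noj; exists j.
pose K := 20 * expR 1 * C / c0.
have width_gt0 j : (0 < width j)%N by rewrite expn_gt0.
have Wj j : (J <= j)%N ->
    \int[mu]_(x in D `&` inner_shell (center j) (width j)) w x <= K / 2 ^+ j.
  move=> Jj; have := le_trans (Ej j Jj) (energy_le _ (width_gt0 j)).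
  rewrite subr_ge0 mulrC -ler_pdivlMr// => /le_trans; apply.
  by rewrite /K /width natrX mulrAC.
(* The last term is the sum of K / 2^j over J <= j < J + i. *)
have bound i : \int[mu]_(x in disk (J + i)) w x <=
    \int[mu]_(x in disk J) w x + 2 * K * (2 ^- J - 2 ^- (J + i)).
  elim: i => [|i IH]; first by rewrite addn0 subrr mulr0 addr0.
  rewrite addnS; apply: le_trans (disk_step _) _.
  apply: le_trans (lerD IH (Wj _ (leq_addr _ _))) _.
  rewrite -addrA lerD2l le_eqVlt; apply/orP; left; apply/eqP.
  have -> : 2 ^- (J + i).+1 = 2 ^- (J + i) / 2 :> R by rewrite exprS invfM mulrC.
  by move: (2 ^- J) (2 ^- (J + i)) => p q; field.
have K0 : 0 <= K by rewrite divr_ge0 ?(ltW c0_gt0)// !mulr_ge0// expR_ge0.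
set B := \int[mu]_(x in disk J) w x + 2 * K * 2 ^- J.
have unionD : \bigcup_i disk (J + i) = D.
  apply/seteqP; split=> [x [i _ []]//|x Dx].
  exists (Num.bound (rho x)) => //; split=> //.
  apply: le_trans (ltW (archi_boundP (rho_ge0 x))) _.
  apply: le_trans (expR_ge1Dx _); rewrite ler_wpDl// ler_nat.
  apply: leq_trans (ltnW (ltn_expl _ (leqnn 2))) _.
  by rewrite leq_exp2l// ltnW// ltnS leq_addl.
have cv : (\int[mu]_(x in disk (J + i)) (w x)%:E @[i --> \oo] --> +oo)%E.
  rewrite -winf -[in X in _ --> X]unionD; apply: ge0_nondecreasing_set_cvg_integral.
  - apply/nondecreasing_seqP => i; rewrite subsetEset => x [Dx xi]; split=> //.
    by apply: le_trans xi _; rewrite ler_expR ler_nat leq_exp2l// addnS.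
  - by move=> i; exact: measurable_disk.
  - by move=> i; exact: measurable_int (integrable_disk _).
  - by move=> i x _; rewrite lee_fin w_ge0.
have : (+oo <= B%:E)%E.
  rewrite -(cvg_lim _ cv)//; apply: lime_le; first by apply/cvg_ex; exists +oo%E.
  apply: nearW => i.
  rewrite -[leLHS]fineK; last first.
    exact: (integrable_fin_num (mu := mu) (measurable_disk _) (integrable_disk _)).
  rewrite lee_fin; apply: le_trans (bound i) _; rewrite lerD2l ler_wpM2l ?(mulr_ge0 _ K0)//.
  by rewrite gerBl invr_ge0 exprn_ge0.
by rewrite leye_eq.
Qed.

Lemma index_infinite : (\int[mu]_(x in D) (w x)%:E = +oo)%E ->
  morse_index test Q = +oo%E.
Proof.
move=> /frequently_negative_energy freq.
have {}freq J : exists j, (J <= j)%N /\ energy (center j) (width j) < 0.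
  by have [j] := freq J; exists j.
have [g gP] := choice freq.
(* A gap of 3 separates the outer shells: the earlier one ends at 5 * 2^(h i), the later one starts
   at 2^(h j) >= 8 * 2^(h i). *)
pose h := fix h i := if i is i'.+1 then g (h i' + 3)%N else g 0%N.
have h_neg i : energy (center (h i)) (width (h i)) < 0.
  by case: i => [|i]; exact: (gP _).2.
have h_step i : (h i + 3 <= h i.+1)%N by exact: (gP _).1.
have h_gap i j : (i < j)%N -> (h i + 3 <= h j)%N.
  elim: j => // j IH; rewrite ltnS leq_eqVlt => /predU1P[->//|/IH ij].
  by apply: leq_trans ij _; apply: leq_trans (h_step j); exact: leq_addr.
have h_disj i j x : (i < j)%N -> outer_shell (center (h i)) (width (h i)) x ->
    outer_shell (center (h j)) (width (h j)) x -> False.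
  move=> ij /andP[_ xi] /andP[xj _]; have := le_trans xj xi.
  rewrite ler_expR /center /width !natrM.
  have b0 : 0 < (2 ^ h i)%:R :> R by rewrite ltr0n expn_gt0.
  have : (2 ^ 3 * 2 ^ h i)%:R <= (2 ^ h j)%:R :> R.
    by rewrite ler_nat -expnD leq_exp2l// addnC h_gap.
  by rewrite natrM; lra.
have neg k : neg_subspace_dim test Q k.
  apply: (@neg_subspace_of_energy k (fun i => center (h i)) (fun i => width (h i))) => //.
  - by move=> i; rewrite expn_gt0.
  - move=> i j x xi xj; apply: val_inj => /=; have [ij|ij|//] := ltngtP i j.
      by case: (h_disj _ _ _ ij xi xj).
    by case: (h_disj _ _ _ ij xj xi).
  - by move=> i; apply: test_family; rewrite expn_gt0.
apply: eq_infty => r.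
have [r0|r0] := leP r 0.
  apply: (@le_trans _ _ 0%E); first by rewrite lee_fin.
  by apply: ereal_sup_ubound; exists 0%N.
apply: (@le_trans _ _ ((Num.bound r)%:R%:E)).
  by rewrite lee_fin; exact: ltW (archi_boundP (ltW r0)).
by apply: ereal_sup_ubound; exists (Num.bound r).
Qed.

End IndexCriterion.

(** * Logarithmic cutoffs and their gradients *)

Section Cutoffs.
Variables (R : realType) (b : R -> R) (C1 c1 : R).
Hypothesis b_smooth : smooth1 setT b.
Hypothesis b01 : forall s, 0 <= b s <= 1.
Hypothesis db_le : forall s, b^`()%classic s ^+ 2 <= C1 * b s.
Hypothesis b_ge : forall s, `|s| <= 1 -> c1 <= b s.
Hypothesis b_supp : forall s, 2 <= `|s| -> b s = 0.
Implicit Types (x : R * R) (c : R) (n : nat) (i : bool).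

Definition coord i x : R := if i then x.2 else x.1.

Lemma derive_rho i x : 'D_(axis R i) (@rho R) x = 2 * coord i x.
Proof.
have E : @rho R = (fun y : R * R => y.1 * y.1) \+ (fun y => y.2 * y.2).
  by apply/funext => y; rewrite /rho !expr2.
have d1 : differentiable (fst : R * R -> R) x := csmooth_diff (@csmooth_fst R setT) I.
have d2 : differentiable (snd : R * R -> R) x := csmooth_diff (@csmooth_snd R setT) I.
rewrite E deriveD; [|by apply: diff_derivable; exact: differentiableM..].
rewrite (@deriveM_at R _ _ (@axis R) fst fst)// (@deriveM_at R _ _ (@axis R) snd snd)//.
rewrite derive_fst derive_snd /axis /coord.
by case: i => /=; ring.
Qed.

Lemma derive_ln_rho i x : 0 < rho x ->
  'D_(axis R i) (fun y => ln (rho y)) x = 2 * coord i x / rho x.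
Proof.
move=> x0; rewrite (@derive_comp1 R _ _ (@ln R) (@rho R)).
- by rewrite derive_rho derive1E; have [_ ->] := is_derive1_ln x0; rewrite mulrC.
- by have [] := is_derive1_ln x0.
- exact: csmooth_diff (csmooth_rho openT) I.
Qed.

Lemma csmooth_ln_rho : csmooth (@axis R) [set x | 0 < rho x] (fun x => ln (rho x)).
Proof.
apply: (csmooth_comp (@open_rho_gt0 R) (@smooth1_ln R)) => //.
exact: csmooth_rho (@open_rho_gt0 R).
Qed.

(** The test on [rho] treats the origin, where [ln] returns a default value at which [b] might not
    vanish. *)
Definition cutoff c n x : R := if 0 < rho x then b ((ln (rho x) - c) / n%:R) else 0.

Lemma cutoff01 c n x : 0 <= cutoff c n x <= 1.
Proof. by rewrite /cutoff; case: ifP => // _; rewrite lexx ler01. Qed.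

Lemma shell_lnE (p q : R) x : 0 < rho x -> shell p q x = (p <= ln (rho x) <= q) :> Prop.
Proof.
move=> x0; have E : expR (ln (rho x)) = rho x by rewrite lnK ?posrE.
by rewrite /shell /= -{1 2}E !ler_expR.
Qed.

Lemma cutoff_outside c n x : (0 < n)%N -> ~ outer_shell c n x -> cutoff c n x = 0.
Proof.
move=> n0 nS; rewrite /cutoff; case: ifPn => // x0; apply: b_supp.
have n0' : 0 < n%:R :> R by rewrite ltr0n.
rewrite normrM normfV (ger0_norm (ltW n0')) ler_pdivlMr//.
rewrite leNgt; apply/negP; rewrite ltr_norml => /andP[h1 h2]; apply: nS.
by rewrite /outer_shell shell_lnE//; apply/andP; split; lra.
Qed.

Lemma cutoff_inside c n x : (0 < n)%N -> inner_shell c n x -> c1 <= cutoff c n x.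
Proof.
move=> n0 /[dup] /shell_gt0 x0; rewrite /cutoff x0.
rewrite /inner_shell shell_lnE// => /andP[h1 h2].
apply: b_ge; have n0' : 0 < n%:R :> R by rewrite ltr0n.
rewrite normrM normfV (ger0_norm (ltW n0')) ler_pdivrMr// mul1r ler_norml.
by apply/andP; split; lra.
Qed.

Lemma open_rho_lt (d : R) : open [set x | rho x < d].
Proof.
rewrite (_ : [set x | _] = @rho R @^-1` [set t | t < d])//.
by apply: open_comp; [move=> x _; exact: continuous_rho|exact: open_lt].
Qed.

(** A function supported in a shell vanishes on the disk inside it, so smoothness off the origin
    extends across the origin, whether or not [U] contains it. *)
Lemma csmooth_near_origin (U : set (R * R)) (f : R * R -> R) (p q : R) : open U ->
  csmooth (@axis R) (U `&` [set x | 0 < rho x]) f ->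
  (forall x, ~ shell p q x -> f x = 0) ->
  csmooth (@axis R) (U `|` [set x | rho x < expR p]) f.
Proof.
move=> oU sf f0.
have sV : csmooth (@axis R) [set x | rho x < expR p] f.
  apply: (csmooth_eq (f := cst 0)); [exact: open_rho_lt| |exact: csmooth_cst].
  by move=> x xp; rewrite f0// => /andP[]; rewrite leNgt xp.
apply: (csmooth_sub _ (csmoothU sf sV)) => x [Ux|]; last by right.
have [x0|x0] := ltP 0 (rho x); first by left.
by right; apply: le_lt_trans x0 _; exact: expR_gt0.
Qed.

Let csmooth_cutoff_arg c n : csmooth (@axis R) [set x | 0 < rho x]
  (fun x => (ln (rho x) - c) / n%:R).
Proof.
have oP := @open_rho_gt0 R.
apply: csmoothM => //; last exact: csmooth_cst.
by apply: csmoothD => //; [exact: csmooth_ln_rho|exact: csmooth_cst].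
Qed.

Lemma csmooth_cutoff c n : (0 < n)%N -> csmooth (@axis R) setT (cutoff c n).
Proof.
move=> n0; have oP := @open_rho_gt0 R.
apply: (csmooth_sub _ (csmooth_near_origin (U := setT) (p := c - n%:R *+ 2)
  (q := c + n%:R *+ 2) openT _ _)) => [x _||]; first by left.
  rewrite setTI; apply: (csmooth_eq (f := b \o (fun x => (ln (rho x) - c) / n%:R))) => //.
    by move=> x x0; rewrite /cutoff ifT.
  by apply: (csmooth_comp oP b_smooth) => //; exact: csmooth_cutoff_arg.
by move=> x; exact: cutoff_outside.
Qed.

Lemma derive_cutoff c n i x : 0 < rho x ->
  'D_(axis R i) (cutoff c n) x =
  b^`()%classic ((ln (rho x) - c) / n%:R) * (2 * coord i x / rho x / n%:R).
Proof.
move=> x0; have oP := @open_rho_gt0 R.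
rewrite (@near_eq_derive _ _ _ _ (b \o (fun x => (ln (rho x) - c) / n%:R))); last first.
  by apply: (near_open_eq oP) => // y y0; rewrite /cutoff ifT.
rewrite derive_comp1.
- congr (_ * _).
  have dl : differentiable (fun y : R * R => ln (rho y)) x := csmooth_diff csmooth_ln_rho x0.
  rewrite (@deriveM_at R _ _ (@axis R) (fun y => ln (rho y) - c) (cst n%:R^-1))//.
    rewrite derive_cst mulr0 add0r deriveB ?derive_cst ?subr0//; last exact: diff_derivable.
    by rewrite derive_ln_rho// mulrC.
  exact: differentiableB.
- apply/derivable1_diffP; exact: csmooth_diff b_smooth I.
- exact: csmooth_diff (csmooth_cutoff_arg c n) x0.
Qed.

Lemma grad2_cutoff_outside c n x : (0 < n)%N -> ~ outer_shell c n x ->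
  grad2 (cutoff c n) x = 0.
Proof.
move=> n0 nS; have cS : closed (outer_shell c n) := @closed_shell R _ _.
by rewrite /grad2 !(derive_outside_closed _ cS (fun y => cutoff_outside n0 (x := y))) // expr0n addr0.
Qed.

(** |grad ln rho|^2 = 4 / rho, and b'^2 <= C1 b keeps one factor of the cutoff on the right. *)
Lemma grad2_cutoff_le c n x : (0 < n)%N ->
  grad2 (cutoff c n) x <= 4 * C1 / n%:R ^+ 2 * cutoff c n x * inv_rho x.
Proof.
move=> n0; have [x0|x0] := ltP 0 (rho x); last first.
  have nS : ~ outer_shell c n x by move/shell_gt0; rewrite ltNge x0.
  by rewrite grad2_cutoff_outside// cutoff_outside// mulr0 mul0r.
have n0' : n%:R != 0 :> R by rewrite pnatr_eq0 -lt0n.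
rewrite /grad2 -/(axis R false) -/(axis R true) !derive_cutoff//= /cutoff x0.
set s := (_ - c) / _; set d := b^`()%classic s.
have -> : (d * (2 * x.1 / rho x / n%:R)) ^+ 2 + (d * (2 * x.2 / rho x / n%:R)) ^+ 2
    = d ^+ 2 * (4 / n%:R ^+ 2 * inv_rho x).
  have : rho x = x.1 ^+ 2 + x.2 ^+ 2 by [].
  have : rho x != 0 by rewrite gt_eqF.
  rewrite /inv_rho; move: (rho x) => r r0 rE.
  have -> : (d * (2 * x.1 / r / n%:R)) ^+ 2 + (d * (2 * x.2 / r / n%:R)) ^+ 2 =
     d ^+ 2 * 4 / n%:R ^+ 2 * (x.1 ^+ 2 + x.2 ^+ 2) / r ^+ 2.
    by field; rewrite r0 n0'.
  by rewrite -rE; field; rewrite r0 n0'.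
have -> : 4 * C1 / n%:R ^+ 2 * b s * inv_rho x = (C1 * b s) * (4 / n%:R ^+ 2 * inv_rho x).
  by ring.
apply: ler_wpM2r; last exact: db_le.
by rewrite mulr_ge0 ?invr_ge0 ?rho_ge0// divr_ge0// exprn_ge0.
Qed.

End Cutoffs.

(** * Combinations of cutoffs with disjoint supports *)

Section CutoffSums.
Variables (R : realType) (b : R -> R).
Hypothesis b_smooth : smooth1 setT b.
Hypothesis b_supp : forall s, 2 <= `|s| -> b s = 0.
Variables (k : nat) (c : 'I_k -> R) (n : 'I_k -> nat) (a : 'I_k -> R).
Hypothesis n_gt0 : forall i, (0 < n i)%N.
Hypothesis disj : forall i j x,
  outer_shell (c i) (n i) x -> outer_shell (c j) (n j) x -> i = j.

Definition cutoff_sum x : R := \sum_(i < k) a i * cutoff b (c i) (n i) x.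

Lemma csmooth_cutoff_sum : csmooth (@axis R) setT cutoff_sum.
Proof.
apply: csmooth_sum; first exact: openT.
move=> i; apply: csmoothM; [exact: openT|exact: csmooth_cst|exact: csmooth_cutoff].
Qed.

Lemma cutoff_sum_supp : exists p q : R, forall x, ~ shell p q x -> cutoff_sum x = 0.
Proof.
exists (- \sum_i `|c i - (n i)%:R *+ 2|), (\sum_i `|c i + (n i)%:R *+ 2|) => x nS.
apply: big1 => i _; rewrite cutoff_outside ?mulr0// => /andP[h1 h2]; apply: nS.
have le_sum (F : 'I_k -> R) : `|F i| <= \sum_j `|F j|.
  by rewrite (bigD1 i)//= lerDl sumr_ge0.
apply/andP; split.
- apply: le_trans h1; rewrite ler_expR lerNl; apply: le_trans (le_sum _).
  by rewrite -normrN ler_norm.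
- by apply: (le_trans h2); rewrite ler_expR; apply: le_trans (le_sum _); exact: ler_norm.
Qed.

Lemma sqr_sum_orth (F : 'I_k -> R) : (forall i j, i != j -> F i * F j = 0) ->
  (\sum_i F i) ^+ 2 = \sum_i F i ^+ 2.
Proof.
move=> F0; rewrite expr2 mulr_suml; apply: eq_bigr => i _.
rewrite mulr_sumr (bigD1 i)//= big1 ?addr0 ?expr2// => j ji.
by apply: F0; rewrite eq_sym.
Qed.

Lemma cutoff_sum_sqr x :
  cutoff_sum x ^+ 2 = \sum_(i < k) a i ^+ 2 * cutoff b (c i) (n i) x ^+ 2.
Proof.
rewrite /cutoff_sum sqr_sum_orth; first by apply: eq_bigr => i _; rewrite exprMn.
move=> i j ij; have [Si|Si] := pselect (outer_shell (c i) (n i) x).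
  rewrite (@cutoff_outside _ b b_supp (c j))// ?mulr0//.
  by move=> Sj; move: ij; rewrite (disj Si Sj) eqxx.
by rewrite (@cutoff_outside _ b b_supp (c i))// mulr0 mul0r.
Qed.

(** The shells are closed, so off its shell each cutoff vanishes on a neighbourhood and so do its
    derivatives; hence the cross terms are zero at every point. *)
Lemma grad2_cutoff_sum x :
  grad2 cutoff_sum x = \sum_(i < k) a i ^+ 2 * grad2 (cutoff b (c i) (n i)) x.
Proof.
have D1 e : 'D_(axis R e) cutoff_sum x =
    \sum_(i < k) a i * 'D_(axis R e) (cutoff b (c i) (n i)) x.
  have -> : cutoff_sum = \sum_(i < k) (fun y => a i * cutoff b (c i) (n i) y).
    by apply/funext => y; rewrite fct_sumE.
  have dc i : differentiable (cutoff b (c i) (n i)) x.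
    exact: csmooth_diff (csmooth_cutoff b_smooth b_supp (c i) (n_gt0 i)) I.
  rewrite derive_sum.
    apply: eq_bigr => i _.
    rewrite (@deriveM_at R _ _ (@axis R) (cst (a i)) (cutoff b (c i) (n i)))//.
    by rewrite derive_cst mulr0 addr0.
  by move=> i; apply: diff_derivable; apply: differentiableM.
have D2 e : ('D_(axis R e) cutoff_sum x) ^+ 2 =
    \sum_(i < k) a i ^+ 2 * ('D_(axis R e) (cutoff b (c i) (n i)) x) ^+ 2.
  rewrite D1 sqr_sum_orth; first by apply: eq_bigr => i _; rewrite exprMn.
  have off i : ~ outer_shell (c i) (n i) x -> 'D_(axis R e) (cutoff b (c i) (n i)) x = 0.
    apply: (derive_outside_closed _ (@closed_shell R _ _)) => y.
    exact: cutoff_outside.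
  move=> i j ij; have [Si|Si] := pselect (outer_shell (c i) (n i) x).
    by rewrite (off j) ?mulr0// => Sj; move: ij; rewrite (disj Si Sj) eqxx.
  by rewrite (off i)// mulr0 mul0r.
rewrite /grad2 (D2 false) (D2 true) -big_split/=.
by apply: eq_bigr => i _; rewrite mulrDr.
Qed.

End CutoffSums.

(** * The weight away from the origin, and compact supports *)

Section Weight.
Variable R : realType.
Implicit Types (x : R * R) (v : R * R -> R) (al : R).

Lemma weight_ge0 al v x : 0 <= weight al v x.
Proof. by rewrite /weight mulr_ge0 ?powR_ge0 ?expR_ge0. Qed.

Lemma powR_enorm x (r : R) : 0 < rho x ->
  enorm x `^ r = expR (r / 2 * ln (rho x)).
Proof.
move=> x0; rewrite /enorm -/(rho x) /powR gt_eqF ?sqrtr_gt0//.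
have -> : ln (rho x) = ln (Num.sqrt (rho x)) *+ 2.
  by rewrite -lnXn ?sqrtr_gt0// sqr_sqrtr// ltW.
by congr expR; field.
Qed.

(** This form turns smoothness of [v] off the origin into smoothness of the weight. *)
Lemma weightE al v x : 0 < rho x -> weight al v x = expR (v x + al * ln (rho x)).
Proof.
by move=> x0; rewrite /weight powR_enorm// -expRD; congr expR; field.
Qed.

Lemma weight_gt0 al v x : 0 < rho x -> 0 < weight al v x.
Proof. by move=> x0; rewrite weightE// expR_gt0. Qed.

Lemma punctE : @punct R = [set x | 0 < rho x].
Proof. by apply/seteqP; split=> x; rewrite /punct /= rho_gt0. Qed.

Lemma compact_closure_support (phi : R * R -> R) (A : set (R * R)) M : 
  (forall x, ~ box M x -> phi x = 0) ->
  compact (closure ([set x | phi x != 0] `&` A)).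
Proof.
move=> phi0; apply: (subclosed_compact _ (@compact_box R M)); first exact: closed_closure.
have /closure_id -> := @closed_box R M; apply: closure_subset => x [/= px _].
by apply: contrapT => /phi0 p0; move: px; rewrite p0 eqxx.
Qed.

Lemma integrable_compact_weight (D : set (R * R)) (w : R * R -> R) : closed D ->
  loc_integrable D w -> forall M, (@leb2 R).-integrable (D `&` box M) (EFin \o w).
Proof.
move=> cD lw M; apply: lw; last exact: subIsetl.
by rewrite setIC; apply: compact_closedI => //; exact: compact_box.
Qed.

Lemma csmooth_grad2 (U : set (R * R)) f : open U -> csmooth (@axis R) U f ->
  csmooth (@axis R) U (grad2 f).
Proof.
move=> oU sf.
rewrite (_ : grad2 f = fun x => 'D_(axis R false) f x * 'D_(axis R false) f x
   + 'D_(axis R true) f x * 'D_(axis R true) f x); last first.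
  by apply/funext => x; rewrite /grad2 !expr2.
by apply: csmoothD => //; apply: csmoothM => //; exact: csmooth_derive.
Qed.

Lemma grad2_outside_box f M x : (forall y, ~ box M y -> f y = 0) -> ~ box M x ->
  grad2 f x = 0.
Proof.
move=> f0 xM; have cB := @closed_box R M.
by rewrite /grad2 !(derive_outside_closed _ cB f0)// expr0n addr0.
Qed.

End Weight.

(** * Index bounds in the whole plane *)

Section WholePlane.
Variables (R : realType) (K0 al : R) (v : R * R -> R).
Hypothesis K0_gt0 : 0 < K0.
Hypothesis v_smooth : csmooth (@axis R) [set x | 0 < rho x] v.
Hypothesis v_int : loc_integrable setT (weight al v).
Variables (b : R -> R) (C1 c1 : R).
Hypothesis C1_gt0 : 0 < C1.
Hypothesis c1_gt0 : 0 < c1.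
Hypothesis b_smooth : smooth1 setT b.
Hypothesis b01 : forall s, 0 <= b s <= 1.
Hypothesis db_le : forall s, b^`()%classic s ^+ 2 <= C1 * b s.
Hypothesis b_ge : forall s, `|s| <= 1 -> c1 <= b s.
Hypothesis b_supp : forall s, 2 <= `|s| -> b s = 0.
Local Notation w := (weight al v).

Lemma inner_outer (c : R) n : inner_shell c n `<=` outer_shell c n.
Proof.
have n0 : 0 <= n%:R :> R by rewrite ler0n.
move=> x /andP[h1 h2]; apply/andP; split.
  by apply: le_trans h1; rewrite ler_expR; lra.
by apply: le_trans h2 _; rewrite ler_expR; lra.
Qed.

(** The cutoff is at most 1 in the gradient bound, at least [c1] on the inner shell, and zero off
    the outer one. *)
Lemma plane_density_le c n x : (0 < n)%N ->
  grad2 (cutoff b c n) x - 2 * K0 * w x * cutoff b c n x ^+ 2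
    <= density w (4 * C1) (2 * K0 * c1 ^+ 2) c n x.
Proof.
move=> n0; rewrite /density !patchE.
have [So|So] := pselect (outer_shell c n x); last first.
  have Si : ~ inner_shell c n x by move/inner_outer.
  rewrite !memNset// (grad2_cutoff_outside b_supp)// (cutoff_outside b_supp)//.
  by rewrite expr0n/= !mulr0.
rewrite (mem_set So).
have /andP[e0 e1] := @cutoff01 R b b01 c n x.
have := @grad2_cutoff_le R b C1 b_smooth db_le b_supp c n x n0.
set e := cutoff b c n x in e0 e1 *; move=> gle.
have cg : 0 <= 4 * C1 / n%:R ^+ 2 * inv_rho x.
  by rewrite mulr_ge0 ?invr_ge0 ?rho_ge0// divr_ge0 ?mulr_ge0 ?(ltW C1_gt0)// exprn_ge0.
apply: lerB.
  by apply: le_trans gle _; rewrite mulrAC ler_piMr.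
have w0 := weight_ge0 al v x.
have [Si|Si] := pselect (inner_shell c n x); last first.
  rewrite memNset//= (_ : point = 0)// mulr0.
  by rewrite mulr_ge0 ?sqr_ge0// mulr_ge0// mulr_ge0// ltW.
rewrite mem_set// -[leRHS]mulrA -[leLHS]mulrA -[leLHS]mulrA -[leRHS]mulrA.
rewrite ler_wpM2l// ler_wpM2l ?(ltW K0_gt0)// mulrC ler_wpM2l//.
have := @cutoff_inside R b c1 b_ge c n x n0 Si; rewrite -/e => c1e.
by rewrite ler_pXn2r ?nnegrE// ltW.
Qed.

Lemma plane_energy_le k (c : 'I_k -> R) (n : 'I_k -> nat) (a : 'I_k -> R) :
  (forall i, (0 < n i)%N) ->
  (forall i j x, outer_shell (c i) (n i) x -> outer_shell (c j) (n j) x -> i = j) ->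
  (Q1 K0 al v (fun x => (\sum_(i < k) a i * cutoff b (c i) (n i) x)%R)
     <= \int[@leb2 R]_x
       (\sum_(i < k) a i ^+ 2 * (1 * density w (4 * C1) (2 * K0 * c1 ^+ 2) (c i) (n i) x))%R%:E)%E.
Proof.
move=> n0 disj; rewrite /Q1 -/(cutoff_sum b c n a).
set eta := cutoff_sum b c n a.
have seta : csmooth (@axis R) setT eta := csmooth_cutoff_sum b_smooth b_supp c a n0.
have [p [q eta0]] : exists p q : R, forall x, ~ shell p q x -> eta x = 0 :=
  cutoff_sum_supp b_supp c a n0.
have eta_box x : ~ box (expR (q / 2)) x -> eta x = 0.
  by move=> nB; apply: eta0 => /shell_box.
have oP := @open_rho_gt0 R.
(* The weight may be singular at the origin, but [eta] vanishes near it, so the product is smooth on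
   the whole plane. *)
have swe : csmooth (@axis R) setT (fun x => 2 * K0 * w x * eta x ^+ 2).
  apply: (csmooth_sub _ (csmooth_near_origin (U := setT) (p := p) (q := q) openT _ _))
    => [x _||x /eta0 ->]; [by left| |by rewrite expr0n/= mulr0].
  rewrite setTI; apply: (csmooth_eq (f := fun x =>
    2 * K0 * expR (v x + al * ln (rho x)) * (eta x * eta x))) => //.
    by move=> x x0; rewrite weightE// expr2.
  have se : csmooth (@axis R) [set x | 0 < rho x] eta by exact: csmooth_sub seta.
  apply: csmoothM => //; last exact: csmoothM.
  apply: csmoothM => //; first exact: (csmooth_cst _ _ (2 * K0)).
  apply: (csmooth_comp oP (@smooth1_expR R setT)) => //.
  apply: csmoothD => //; apply: csmoothM => //; first exact: (csmooth_cst _ _ al).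
  exact: csmooth_ln_rho.
apply: le_integral => //.
- apply: (integrable_continuous_box (U := setT) (F := setT) (M := expR (q / 2)) openT _ _ _ _
    (f := fun x => grad2 eta x - 2 * K0 * w x * eta x ^+ 2)) => //.
  + move=> x _; apply: (continuousB (V := R)).
      exact: csmooth_continuous (csmooth_grad2 openT seta) I.
    exact: csmooth_continuous swe I.
  + by move=> x _ nB; rewrite (grad2_outside_box eta_box)// eta_box// expr0n/= mulr0 subr0.
- have iw M : (@leb2 R).-integrable (setT `&` box M) (EFin \o w).
    exact: integrable_compact_weight closedT v_int M.
  exact: (@integrable_density_sum R setT w measurableT iw (4 * C1) (2 * K0 * c1 ^+ 2)
    (fun=> 1) k c n a).
- move=> x _; rewrite lee_fin /eta (cutoff_sum_sqr b_supp a n0 disj).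
  rewrite (grad2_cutoff_sum b_smooth b_supp a n0 disj) mulr_sumr -sumrB.
  apply: ler_sum => i _.
  rewrite mul1r mulrCA -mulrBr; apply: ler_wpM2l; first exact: sqr_ge0.
  exact: plane_density_le.
Qed.

Lemma plane_test c n : (0 < n)%N -> test_fun (cutoff b c n).
Proof.
move=> n0; split; first by apply/smooth_onP; split; [exact: openT|exact: csmooth_cutoff].
rewrite -[X in closure X]setIT.
apply: (@compact_closure_support _ _ _ (expR ((c + n%:R *+ 2) / 2))) => x nB.
by apply: (cutoff_outside b_supp n0) => /shell_box.
Qed.

Let whole_square : `[2^-1, 1]%classic `*` `[2^-1, 1]%classic `<=` [set: R * R].
Proof. by []. Qed.

Lemma plane_index : (1%:E <= ind1 K0 al v)%E /\
  ((\int[@leb2 R]_x (w x)%:E = +oo)%E -> ind1 K0 al v = +oo%E).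
Proof.
have iw M : (@leb2 R).-integrable (setT `&` box M) (EFin \o w).
  exact: integrable_compact_weight closedT v_int M.
have w_gt0 x : setT x -> 0 < rho x -> 0 < w x by move=> _; exact: weight_gt0.
have C0 : 0 <= 4 * C1 by rewrite mulr_ge0// ltW.
have c0 : 0 < 2 * K0 * c1 ^+ 2 by rewrite !mulr_gt0// exprn_gt0.
have k0 n : (0 < n)%N -> 0 < 1 :> R by [].
split.
  exact: (@index_ge1 R setT w measurableT (weight_ge0 al v) w_gt0 iw whole_square
    _ _ C0 c0 _ _ _ (fun=> 1) k0 plane_test plane_energy_le).
exact: (@index_infinite R setT w measurableT (weight_ge0 al v) iw
  _ _ C0 c0 _ _ _ (fun=> 1) k0 plane_test plane_energy_le).
Qed.

End WholePlane.

(** * Harmonicity of ln |x|^2 off the origin *)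

Lemma laplacianE (R : realType) (f : R * R -> R) x : laplacian f x =
  'D_(axis R false) ('D_(axis R false) f) x + 'D_(axis R true) ('D_(axis R true) f) x.
Proof. by []. Qed.

Lemma grad2E (R : realType) (f : R * R -> R) x : grad2 f x =
  'D_(axis R false) f x ^+ 2 + 'D_(axis R true) f x ^+ 2.
Proof. by []. Qed.

Section LogRho.
Variable R : realType.
Implicit Types (x : R * R) (i : bool).

Lemma derive2_ln_rho i x : 0 < rho x ->
  'D_(axis R i) ('D_(axis R i) (fun y => ln (rho y))) x
    = 2 / rho x - 4 * coord i x ^+ 2 / rho x ^+ 2.
Proof.
move=> x0; have oP := @open_rho_gt0 R.
rewrite (@near_eq_derive _ _ _ _ (fun y => (2 * coord i y) * inv_rho y)); last first.
  by apply: (near_open_eq oP) => // y y0; rewrite derive_ln_rho.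
have scoord : csmooth (@axis R) setT (fun y : R * R => 2 * coord i y).
  apply: csmoothM; [exact: openT|exact: csmooth_cst|rewrite /coord].
  by case: i; [exact: csmooth_snd|exact: csmooth_fst].
have dinv : 'D_(axis R i) (@inv_rho R) x = - (2 * coord i x) / rho x ^+ 2.
  have dr : differentiable (@rho R) x := csmooth_diff (csmooth_rho openT) I.
  rewrite (@derive_comp1 R _ _ (fun t : R => t^-1) (@rho R))//; last first.
    by apply: derivableV; [rewrite gt_eqF|exact: derivable_id].
  rewrite derive1E deriveV ?gt_eqF// derive_id derive_rho /GRing.scale/= mulr1.
  by rewrite mulNr mulrC mulNr.
rewrite (@deriveM_at R _ _ (@axis R) (fun y => 2 * coord i y) (@inv_rho R)); last 2 first.
- exact: csmooth_diff scoord I.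
- exact: csmooth_diff (@csmooth_inv_rho R) x0.
have -> : 'D_(axis R i) (fun y : R * R => 2 * coord i y) x = 2.
  rewrite (@deriveM_at R _ _ (@axis R) (cst 2) (coord i))//.
    rewrite derive_cst mulr0 addr0 /coord.
    by case: i {scoord dinv}; rewrite ?derive_fst ?derive_snd /axis/= mulr1.
  rewrite /coord; case: i {scoord dinv}.
    exact: (csmooth_diff (@csmooth_snd R setT) I).
  exact: (csmooth_diff (@csmooth_fst R setT) I).
rewrite dinv /inv_rho; have : rho x != 0 by rewrite gt_eqF.
by move: (rho x) (coord i x) => r t r0; field.
Qed.

(** Hence the logarithmic term of [conf] leaves the equation for [v] unchanged. *)
Lemma laplacian_ln_rho x : 0 < rho x -> laplacian (fun y => ln (rho y)) x = 0.
Proof.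
move=> x0; rewrite laplacianE !derive2_ln_rho//=.
have -> : x.1 = coord false x by []; have -> : x.2 = coord true x by [].
have : rho x = coord false x ^+ 2 + coord true x ^+ 2 by [].
have : rho x != 0 by rewrite gt_eqF.
move: (rho x) (coord false x) (coord true x) => r s t r0 rE.
have -> : 2 / r - 4 * s ^+ 2 / r ^+ 2 + (2 / r - 4 * t ^+ 2 / r ^+ 2) =
  4 * (r - (s ^+ 2 + t ^+ 2)) / r ^+ 2 by field.
by rewrite -rE subrr mulr0 mul0r.
Qed.

End LogRho.

(** * Half-plane: an energy identity that removes the boundary term *)

Section HalfPlane.
Variables (R : realType) (K0 h0 be : R) (v g : R * R -> R) (U : set (R * R)).
Hypothesis oU : open U.
Hypothesis half_U : @cl_half R `&` @punct R `<=` U.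
Hypothesis g_smooth : csmooth (@axis R) U g.
Hypothesis gv : forall x, (@cl_half R `&` @punct R) x -> g x = v x.
Hypothesis pde : forall x, @op_half R x -> - laplacian v x = 2 * K0 * weight be v x.
Hypothesis bdry : forall s : R, s != 0 ->
  - 'D_(e2 R) g (s, 0) = 2 * h0 * (enorm (s, 0) `^ be) * expR (v (s, 0) / 2).
Local Notation w := (weight be v).
Implicit Types (x : R * R) (i : bool).

(** The solution read in the conformal coordinates (ln |x|, angle), where the weight becomes
    [expR conf] = |x|^(2 be + 2) e^v. The extension [g] replaces [v] because derivatives are taken
    at boundary points. *)
Definition conf x : R := g x + (be + 1) * ln (rho x).

Let UP : set (R * R) := U `&` [set x | 0 < rho x].

Let oUP : open UP.
Proof. by apply: openI => //; exact: open_rho_gt0. Qed.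

Lemma csmooth_conf : csmooth (@axis R) UP conf.
Proof.
apply: csmoothD => //; first by apply: (csmooth_sub _ g_smooth); exact: subIsetl.
apply: csmoothM => //; first exact: csmooth_cst.
by apply: (csmooth_sub _ (@csmooth_ln_rho R)); exact: subIsetr.
Qed.

Lemma half_gt0 x : @op_half R x -> 0 < rho x.
Proof. by move=> x2; rewrite /rho ltr_wpDl ?sqr_ge0// exprn_gt0. Qed.

Lemma cl_half_UP x : @cl_half R x -> 0 < rho x -> UP x.
Proof. by move=> hx x0; split=> //; apply: half_U; split=> //; rewrite punctE. Qed.

Lemma expR_conf x : @cl_half R x -> 0 < rho x -> expR (conf x) = w x * rho x.
Proof.
move=> hx x0; have -> : w x * rho x = w x * expR (ln (rho x)) by rewrite lnK ?posrE.
rewrite weightE// /conf gv; last by split=> //; rewrite punctE.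
by rewrite -expRD; congr expR; ring.
Qed.

Lemma csmooth_expR_conf (k : R) : csmooth (@axis R) UP (fun x => expR (k * conf x)).
Proof.
apply: (csmooth_comp oUP (@smooth1_expR R setT)) => //.
by apply: csmoothM => //; [exact: csmooth_cst|exact: csmooth_conf].
Qed.

Lemma derive_expR_conf (k : R) i x : UP x ->
  'D_(axis R i) (fun y => expR (k * conf y)) x
    = k * 'D_(axis R i) conf x * expR (k * conf x).
Proof.
move=> Ux; have dc : differentiable conf x := csmooth_diff csmooth_conf Ux.
rewrite (@derive_comp1 R _ _ expR (fun y => k * conf y)).
- rewrite (@deriveM_at R _ _ (@axis R) (cst k) conf)// derive_cst mulr0 addr0.
  by rewrite derive1E derive_val mulrC.
- exact: derivable_expR.
- by apply: differentiableM.
Qed.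

Lemma laplacian_conf x : @op_half R x -> laplacian conf x = - (2 * K0 * w x).
Proof.
move=> hx; have x0 := half_gt0 hx.
have Ux : UP x by apply: cl_half_UP => //; exact: ltW.
have oP := @open_rho_gt0 R.
have dgl i : 'D_(axis R i) ('D_(axis R i) conf) x =
    'D_(axis R i) ('D_(axis R i) g) x
    + (be + 1) * 'D_(axis R i) ('D_(axis R i) (fun y => ln (rho y))) x.
  have scl : csmooth (@axis R) UP (fun y => (be + 1) * 'D_(axis R i) (fun y => ln (rho y)) y).
    apply: csmoothM => //; first exact: csmooth_cst.
    apply: (csmooth_sub _ (csmooth_derive i (@csmooth_ln_rho R))).
    exact: subIsetr.
  rewrite (@near_eq_derive _ _ _ _ (fun y => 'D_(axis R i) g y
    + (be + 1) * 'D_(axis R i) (fun y => ln (rho y)) y)); last first.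
    apply: (near_open_eq oUP) => // y [Uy y0].
    have dg : differentiable g y := csmooth_diff g_smooth Uy.
    have dl : differentiable (fun y => ln (rho y)) y := csmooth_diff (@csmooth_ln_rho R) y0.
    rewrite [LHS]deriveD; [|exact: diff_derivable|apply: diff_derivable; exact: differentiableM].
    congr (_ + _).
    rewrite (@deriveM_at R _ _ (@axis R) (cst (be + 1)) (fun y => ln (rho y)))//.
    by rewrite derive_cst mulr0 addr0.
  have dDg : differentiable ('D_(axis R i) g) x := csmooth_diff (csmooth_derive i g_smooth) Ux.1.
  have dDl : differentiable ('D_(axis R i) (fun y => ln (rho y))) x :=
    csmooth_diff (csmooth_derive i (@csmooth_ln_rho R)) x0.
  rewrite [LHS]deriveD; [|exact: diff_derivable|by apply: diff_derivable; exact: differentiableM].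
  congr (_ + _).
  rewrite (@deriveM_at R _ _ (@axis R) (cst (be + 1)) ('D_(axis R i) (fun y => ln (rho y))))//.
  by rewrite derive_cst mulr0 addr0.
have lap_gv : laplacian g x = laplacian v x.
  have gv_op y : @op_half R y -> g y = v y.
    by move=> hy; apply: gv; split; [exact: ltW|rewrite punctE; exact: half_gt0].
  have near2 i : 'D_(axis R i) ('D_(axis R i) g) x = 'D_(axis R i) ('D_(axis R i) v) x.
    apply: near_eq_derive; apply: (near_open_eq (@open_op_half R) _ hx) => y hy.
    apply: near_eq_derive; exact: (near_open_eq (@open_op_half R) gv_op hy).
  by rewrite !laplacianE !near2.
have alg (A1 A2 B1 B2 r t : R) : B1 + B2 = 0 -> A1 + A2 = t ->
    A1 + r * B1 + (A2 + r * B2) = t.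
  by move=> B0 <-; rewrite addrACA -mulrDr B0 mulr0 addr0.
apply: (etrans (congr2 +%R (dgl false) (dgl true))).
apply: (alg _ _ _ _ _ _ (laplacian_ln_rho x0)); apply: (etrans lap_gv).
by rewrite -(pde hx) opprK.
Qed.

Section EnergyIdentity.
Variables (eta : R * R -> R) (p q : R).
Hypothesis eta_smooth : csmooth (@axis R) setT eta.
Hypothesis eta_supp : forall x, ~ shell p q x -> eta x = 0.

(** [U] may miss the origin. Adding a disk on which [eta] vanishes gives a neighbourhood of the
    whole closed half-plane where every expression containing a factor [eta] is smooth. *)
Let W : set (R * R) := U `|` [set x | rho x < expR p].

Let oW : open W.
Proof. by apply: openU => //; exact: open_rho_lt. Qed.

Let half_W : @cl_half R `<=` W.
Proof.
move=> x hx; have [x0|x0] := ltP 0 (rho x); first by left; have [] := cl_half_UP hx x0.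
by right; apply: le_lt_trans x0 _; exact: expR_gt0.
Qed.

Let off_box (f : R * R -> R) : (forall x, eta x = 0 -> f x = 0) ->
  forall x, ~ box (expR (q / 2)) x -> f x = 0.
Proof. by move=> f0 x nB; apply: f0; apply: eta_supp => /shell_box. Qed.

Let csmooth_W (f : R * R -> R) : csmooth (@axis R) UP f ->
  (forall x, eta x = 0 -> f x = 0) -> csmooth (@axis R) W f.
Proof.
by move=> sf f0; apply: (csmooth_near_origin oU sf) => x /eta_supp /f0.
Qed.

Let seta : csmooth (@axis R) UP eta.
Proof. by apply: (csmooth_sub _ eta_smooth). Qed.

Definition transformed x : R := eta x * expR (2^-1 * conf x).

Lemma csmooth_transformed : csmooth (@axis R) W transformed.
Proof.
apply: csmooth_W; last by move=> x; rewrite /transformed => ->; rewrite mul0r.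
by apply: csmoothM => //; exact: csmooth_expR_conf.
Qed.

Lemma transformed_test : test_fun_half transformed.
Proof.
split.
  exists W, transformed; split; [exact: half_W|split=> //].
  by apply/smooth_onP; split=> //; exact: csmooth_transformed.
apply: (@compact_closure_support _ _ _ (expR (q / 2))).
by apply: off_box => x; rewrite /transformed => ->; rewrite mul0r.
Qed.

(* The vector field eta^2 psi grad psi, where psi = expR (conf / 2). *)
Let field i x : R := 2^-1 * (eta x * eta x) * (expR (1 * conf x) * 'D_(axis R i) conf x).

Let field_smooth i : csmooth (@axis R) W (field i).
Proof.
apply: csmooth_W; last by move=> x; rewrite /field => ->; rewrite !(mul0r, mulr0).
apply: csmoothM => //.
  by apply: csmoothM => //; [exact: csmooth_cst|exact: csmoothM].
by apply: csmoothM => //; [exact: csmooth_expR_conf|exact: csmooth_derive csmooth_conf].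
Qed.

Let field_box i x : ~ box (expR (q / 2)) x -> field i x = 0.
Proof. by apply: off_box => y; rewrite /field => ->; rewrite !(mul0r, mulr0). Qed.

Let derive_field i x : UP x -> 'D_(axis R i) (field i) x =
  expR (conf x) * (eta x * 'D_(axis R i) eta x * 'D_(axis R i) conf x
   + 2^-1 * eta x ^+ 2 * ('D_(axis R i) conf x) ^+ 2
   + 2^-1 * eta x ^+ 2 * 'D_(axis R i) ('D_(axis R i) conf) x).
Proof.
move=> Ux; have de : differentiable eta x := csmooth_diff eta_smooth I.
have dE : differentiable (fun y => expR (1 * conf y)) x := csmooth_diff (csmooth_expR_conf 1) Ux.
have dD : differentiable ('D_(axis R i) conf) x := csmooth_diff (csmooth_derive i csmooth_conf) Ux.
rewrite (@deriveM_at R _ _ (@axis R) (fun y => 2^-1 * (eta y * eta y))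
  (fun y => expR (1 * conf y) * 'D_(axis R i) conf y)); last 2 first.
- by apply: differentiableM => //; exact: differentiableM.
- exact: differentiableM.
rewrite (@deriveM_at R _ _ (@axis R) (cst 2^-1) (fun y => eta y * eta y))//; last exact: differentiableM.
rewrite (@deriveM_at R _ _ (@axis R) eta eta)// derive_cst.
rewrite (@deriveM_at R _ _ (@axis R) (fun y => expR (1 * conf y)) ('D_(axis R i) conf))//.
by rewrite derive_expR_conf// !mul1r /cst; field.
Qed.

Let derive_transformed i x : UP x -> 'D_(axis R i) transformed x =
  expR (2^-1 * conf x) * ('D_(axis R i) eta x + 2^-1 * eta x * 'D_(axis R i) conf x).
Proof.
move=> Ux; have de : differentiable eta x := csmooth_diff eta_smooth I.
have dE : differentiable (fun y => expR (2^-1 * conf y)) x :=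
  csmooth_diff (csmooth_expR_conf 2^-1) Ux.
rewrite (@deriveM_at R _ _ (@axis R) eta (fun y => expR (2^-1 * conf y)))//.
by rewrite derive_expR_conf//; ring.
Qed.

Definition reduced x : R :=
  expR (conf x) * (grad2 eta x - eta x ^+ 2 * (K0 * w x + grad2 conf x / 4)).

(** The integrand of [Q2], with the weight written as exp(conf) / rho: [v] is controlled only on the
    closed half-plane, whereas integrability is derived from smoothness on the open set [W]. *)
Let full x : R := grad2 transformed x
  - 2 * K0 * (expR (1 * conf x) * (rho x)^-1) * transformed x ^+ 2.

Let fullE x : @op_half R x -> full x =
  grad2 transformed x - 2 * K0 * w x * transformed x ^+ 2.
Proof.
move=> hx; have x0 := half_gt0 hx; rewrite /full mul1r expR_conf//; last exact: ltW.
by rewrite mulfK// gt_eqF.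
Qed.

(** With psi = exp(conf / 2), |grad(eta psi)|^2 = psi^2 |grad eta|^2 + div(eta^2 psi grad psi) -
    eta^2 psi Lap psi. The equation gives psi Lap psi = psi^2 (|grad conf|^2 / 4 - K0 w). *)
Let full_split x : @op_half R x ->
  full x = reduced x
    + ('D_(axis R false) (field false) x + 'D_(axis R true) (field true) x).
Proof.
move=> hx; have x0 := half_gt0 hx; have Ux : UP x by apply: cl_half_UP => //; exact: ltW.
have lapE := laplacian_conf hx.
have alg (E2 e w0 e1' e2' u1 u2 u11 u22 : R) : u11 + u22 = - (2 * K0 * w0) ->
    (E2 * (e1' + 2^-1 * e * u1)) ^+ 2 + (E2 * (e2' + 2^-1 * e * u2)) ^+ 2
      - 2 * K0 * w0 * (e * E2) ^+ 2
    = E2 ^+ 2 * (e1' ^+ 2 + e2' ^+ 2 - e ^+ 2 * (K0 * w0 + (u1 ^+ 2 + u2 ^+ 2) / 4))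
    + (E2 ^+ 2 * (e * e1' * u1 + 2^-1 * e ^+ 2 * u1 ^+ 2 + 2^-1 * e ^+ 2 * u11)
     + E2 ^+ 2 * (e * e2' * u2 + 2^-1 * e ^+ 2 * u2 ^+ 2 + 2^-1 * e ^+ 2 * u22)).
  move=> lap; have -> : u11 = - (2 * K0 * w0) - u22 by rewrite -lap addrK.
  by field.
have E2E : expR (conf x) = expR (2^-1 * conf x) ^+ 2.
  by rewrite -expRM_natl mulrA divff ?pnatr_eq0// mul1r.
have := alg (expR (2^-1 * conf x)) (eta x) (w x)
  ('D_(axis R false) eta x) ('D_(axis R true) eta x)
  ('D_(axis R false) conf x) ('D_(axis R true) conf x) _ _ lapE.
rewrite -E2E => H.
rewrite fullE//; apply: etrans (etrans H _).
  by congr (_ ^+ 2 + _ ^+ 2 - _); [exact: (@derive_transformed false x Ux)|exact: (@derive_transformed true x Ux)].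
by congr (_ + (_ + _)); apply: esym; [exact: (@derive_field false x Ux)|exact: (@derive_field true x Ux)].
Qed.

Let full_integrable : (@leb2 R).-integrable (@op_half R) (EFin \o full).
Proof.
apply: (@integrable_op_half R W _ (expR (q / 2))) => //.
  rewrite /full; apply: (csmooth_eq (f := fun x => grad2 transformed x + -1 *
    (2 * K0 * (expR (1 * conf x) * (rho x)^-1) * transformed x ^+ 2))) => //.
    by move=> x _; rewrite mulN1r.
  apply: csmoothD => //; first exact: csmooth_grad2 csmooth_transformed.
  apply: csmoothM => //; first exact: csmooth_cst.
  apply: csmooth_W; last by move=> x; rewrite /transformed => ->; rewrite mul0r expr0n/= mulr0.
  apply: (csmooth_eq (f := fun x => 2 * K0 * (expR (1 * conf x) * (rho x)^-1)
     * (transformed x * transformed x))) => //.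
  have sT : csmooth (@axis R) UP transformed.
    by apply: csmoothM => //; exact: csmooth_expR_conf.
  apply: csmoothM => //; last exact: csmoothM.
  apply: csmoothM => //; first exact: (csmooth_cst _ _ (2 * K0)).
  apply: csmoothM => //; first exact: csmooth_expR_conf.
  by apply: (csmooth_sub _ (@csmooth_inv_rho R)); exact: subIsetr.
have t0 x : ~ box (expR (q / 2)) x -> transformed x = 0.
  by apply: off_box => y; rewrite /transformed => ->; rewrite mul0r.
by move=> x nB; rewrite /full (grad2_outside_box t0)// t0// expr0n/= mulr0 subr0.
Qed.

Let field_integrable i :
  (@leb2 R).-integrable (@op_half R) (EFin \o 'D_(axis R i) (field i)).
Proof.
apply: (@integrable_op_half R W _ (expR (q / 2))) => //.
  exact: csmooth_derive (field_smooth i).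
by move=> x; apply: derive_outside_closed; [exact: closed_box|exact: field_box].
Qed.

Lemma reduced_integrable : (@leb2 R).-integrable (@op_half R) (EFin \o reduced).
Proof.
have i1 := integrableB (mu := @leb2 R) (@measurable_op_half R) full_integrable (field_integrable false).
have i2 := integrableB (mu := @leb2 R) (@measurable_op_half R) i1 (field_integrable true).
have alg (f r d1 d2 : R) : f = r + (d1 + d2) -> f - d1 - d2 = r.
  by move=> ->; rewrite [d1 + d2]addrC addrA !addrK.
apply: (eq_integrable (mu := @leb2 R) (@measurable_op_half R) _ _ _ i2) => x.
rewrite inE => hx; exact: (congr1 EFin (alg _ _ _ _ (full_split hx))).
Qed.

(** The vertical derivative of ln rho vanishes on the boundary line, so [conf] inherits the boundary
    condition of [g]; halving it gives the coefficient [h0]. *)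
Let boundary_field (s : R) : - field true (s, 0) =
  h0 * (enorm (s, 0) `^ be) * expR (v (s, 0) / 2) * transformed (s, 0) ^+ 2.
Proof.
(* At the origin the boundary condition says nothing, but both sides vanish because [eta] does. *)
have [->|s0] := eqVneq s 0.
  have e0 : eta (0, 0) = 0 by apply: eta_supp => /shell_gt0; rewrite rho_gt0 eqxx.
  by rewrite /field /transformed e0 !(mul0r, mulr0) oppr0 expr0n/= mulr0.
have x0 : 0 < rho (s, 0 : R) by rewrite rho_gt0 xpair_eqE (negbTE s0).
have hx : @cl_half R (s, 0) by rewrite /cl_half/=.
have Ux := cl_half_UP hx x0.
have Dc : 'D_(e2 R) conf (s, 0) = 'D_(e2 R) g (s, 0).
  have dg : differentiable g (s, 0 : R) := csmooth_diff g_smooth Ux.1.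
  have dl : differentiable (fun y : R * R => ln (rho y)) (s, 0) :=
    csmooth_diff (@csmooth_ln_rho R) x0.
  rewrite [LHS]deriveD; [|exact: diff_derivable|by apply: diff_derivable; exact: differentiableM].
  rewrite -/(axis R true) (@deriveM_at R _ _ (@axis R) (cst (be + 1)) (fun y => ln (rho y)))//.
  by rewrite derive_cst mulr0 addr0 derive_ln_rho// /coord/= mulr0 mul0r mulr0 addr0.
have alg (E1 E2 e G B V : R) : E2 ^+ 2 = E1 -> - G = 2 * h0 * B * V ->
    - (2^-1 * (e * e) * (E1 * G)) = h0 * B * V * (e * E2) ^+ 2.
  by move=> <- GE; rewrite -[G]opprK GE; field.
have E2E : expR (2^-1 * conf (s, 0)) ^+ 2 = expR (1 * conf (s, 0)).
  by rewrite -expRM_natl mulrA divff ?pnatr_eq0.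
by apply: (alg _ _ _ _ _ _ E2E); rewrite -(bdry s0) -Dc.
Qed.

(** Of the divergence, the horizontal part integrates to 0 and the vertical part to the boundary
    integral that [Q2] subtracts. *)
Lemma Q2_transformed :
  (Q2 K0 h0 be v transformed = \int[@leb2 R]_(x in @op_half R) (reduced x)%:E)%E.
Proof.
have mH := @measurable_op_half R.
(* Cancelling the boundary integral in the extended reals requires it to be finite. *)
have alg (A r j1 j2 B : \bar R) : A = (r + (j1 + j2))%E -> j1 = 0%E -> j2 = B ->
    j2 \is a fin_num -> (A - B = r)%E.
  by move=> -> -> <- fj; rewrite add0e addeK.
have i1 := field_integrable false; have i2 := field_integrable true.
have i12 := integrableD (mu := @leb2 R) mH i1 i2.
have split_integral : (\int[@leb2 R]_(x in @op_half R)
    (grad2 transformed x - 2 * K0 * w x * transformed x ^+ 2)%:E =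
  \int[@leb2 R]_(x in @op_half R) (reduced x)%:E +
   (\int[@leb2 R]_(x in @op_half R) ('D_(axis R false) (field false) x)%:E +
    \int[@leb2 R]_(x in @op_half R) ('D_(axis R true) (field true) x)%:E))%E.
  apply: etrans (etrans (integralD (mu := @leb2 R) mH reduced_integrable i12) _).
    apply: eq_integral => x; rewrite inE => hx.
    exact: (congr1 EFin (etrans (esym (fullE hx)) (full_split hx))).
  by congr (_ + _)%E; exact: (integralD (mu := @leb2 R) mH i1 i2).
apply: (alg _ _ _ _ _ split_integral).
- exact: (integral_op_half_derive1 oW half_W (field_smooth false) (@field_box false)).
- apply: etrans (integral_op_half_derive2 oW half_W (field_smooth true) (@field_box true)) _.
  by apply: eq_integral => s _; rewrite boundary_field.
- exact: (integrable_fin_num (mu := @leb2 R) mH i2).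
Qed.

End EnergyIdentity.
End HalfPlane.

(** * Index bounds in the half-plane *)

Section HalfPlaneIndex.
Variables (R : realType) (K0 h0 be : R) (v g : R * R -> R) (U : set (R * R)).
Hypothesis K0_gt0 : 0 < K0.
Hypothesis oU : open U.
Hypothesis half_U : @cl_half R `&` @punct R `<=` U.
Hypothesis g_smooth : csmooth (@axis R) U g.
Hypothesis gv : forall x, (@cl_half R `&` @punct R) x -> g x = v x.
Hypothesis pde : forall x, @op_half R x -> - laplacian v x = 2 * K0 * weight be v x.
Hypothesis bdry : forall s : R, s != 0 ->
  - 'D_(e2 R) g (s, 0) = 2 * h0 * (enorm (s, 0) `^ be) * expR (v (s, 0) / 2).
Hypothesis v_int : loc_integrable (@cl_half R) (weight be v).
Variables (b : R -> R) (C1 c1 : R).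
Hypothesis c1_gt0 : 0 < c1.
Hypothesis b_smooth : smooth1 setT b.
Hypothesis b01 : forall s, 0 <= b s <= 1.
Hypothesis db_le : forall s, b^`()%classic s ^+ 2 <= C1 * b s.
Hypothesis b_ge : forall s, `|s| <= 1 -> c1 <= b s.
Hypothesis b_supp : forall s, 2 <= `|s| -> b s = 0.
Local Notation w := (weight be v).
Local Notation C := ((4 * C1 + 1) ^+ 2 / (4 * K0)).
Local Notation kap := (fun n : nat => (n%:R ^+ 2)^-1 : R).
Local Notation family := (fun c n => transformed be g (cutoff b c n)).

Let iw M : (@leb2 R).-integrable (@op_half R `&` box M) (EFin \o w).
Proof.
have := integrable_compact_weight (@closed_cl_half R) v_int M.
apply: (integrableS (mu := @leb2 R)).
- apply: measurableI; last exact: measurable_box.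
  by apply: closed_measurable_plane; exact: closed_cl_half.
- by apply: measurableI; [exact: measurable_op_half|exact: measurable_box].
- by apply: setSI; exact: op_half_cl.
Qed.

(* AM-GM: the gradient term 4 C1 e w / n^2 is absorbed by K0 rho (e w)^2. *)
Lemma half_density_le c n x : (0 < n)%N -> @op_half R x ->
  (w x * rho x) * (grad2 (cutoff b c n) x - K0 * w x * cutoff b c n x ^+ 2)
    <= kap n * density w C c1 c n x.
Proof.
move=> n0 hx; have x0 := half_gt0 hx; rewrite /density !patchE.
have [So|So] := pselect (outer_shell c n x); last first.
  have Si : ~ inner_shell c n x by move/inner_outer.
  rewrite !memNset// (grad2_cutoff_outside b_supp)// (cutoff_outside b_supp)//.
  by rewrite expr0n/= (_ : point = 0)// !mulr0 subrr !mulr0.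
rewrite (mem_set So).
have /andP[e0 e1] := @cutoff01 R b b01 c n x.
have := @grad2_cutoff_le R b C1 b_smooth db_le b_supp c n x n0.
have inw : c1 * (if x \in inner_shell c n then w x else point) <= cutoff b c n x * w x.
  have [Si|Si] := pselect (inner_shell c n x).
    rewrite mem_set// ler_wpM2r ?weight_ge0//.
    exact: (@cutoff_inside R b c1 b_ge c n x n0 Si).
  by rewrite memNset//= (_ : point = 0)// mulr0 mulr_ge0// weight_ge0.
move: inw; set inn := (if _ then _ else _); move: inn => inn.
have N0 : 0 < (n%:R ^+ 2)^-1 :> R by rewrite invr_gt0 exprn_gt0// ltr0n.
have W0 := weight_gt0 be v x0.
rewrite /inv_rho; move: e0 e1 N0 W0 x0.
move: (cutoff b c n x) (w x) (rho x) ((n%:R ^+ 2)^-1) (grad2 _ x) => e W r N G.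
move=> e0 e1 N0 W0 r0 inw Gle.
have WG : W * r * G <= 4 * C1 * N * (e * W).
  have -> : 4 * C1 * N * (e * W) = W * r * (4 * C1 * N * e * r^-1).
    by field; rewrite gt_eqF.
  by rewrite ler_wpM2l// mulr_ge0// ltW.
(* The constant [C] comes from completing the square with 4 C1 + 1 instead of 4 C1: the extra 1
   leaves the negative term -N e W, which is linear in the weight. *)
have sq : 4 * C1 * N * (e * W) - K0 * r * (e * W) ^+ 2 <= C * N ^+ 2 / r - N * (e * W).
  rewrite -subr_ge0.
  have -> : C * N ^+ 2 / r - N * (e * W) - (4 * C1 * N * (e * W) - K0 * r * (e * W) ^+ 2)
    = (2 * K0 * r * (e * W) - (4 * C1 + 1) * N) ^+ 2 / (4 * K0 * r).
    by field; rewrite !gt_eqF.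
  by rewrite divr_ge0 ?sqr_ge0// !mulr_ge0// ltW.
have Ninw : N * (c1 * inn) <= N * (e * W) by rewrite ler_wpM2l// ltW.
have -> : W * r * (G - K0 * W * e ^+ 2) = W * r * G - K0 * r * (e * W) ^+ 2 by ring.
have -> : N * (C * N * r^-1 - c1 * inn) = C * N ^+ 2 / r - N * (c1 * inn) by ring.
lra.
Qed.

Lemma half_energy_le k (c : 'I_k -> R) (n : 'I_k -> nat) (a : 'I_k -> R) :
  (forall i, (0 < n i)%N) ->
  (forall i j x, outer_shell (c i) (n i) x -> outer_shell (c j) (n j) x -> i = j) ->
  (Q2 K0 h0 be v (fun x => (\sum_(i < k) a i * family (c i) (n i) x)%R)
     <= \int[@leb2 R]_(x in @op_half R)
       (\sum_(i < k) a i ^+ 2 * (kap (n i) * density w C c1 (c i) (n i) x))%R%:E)%E.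
Proof.
move=> n0 disj; set eta := cutoff_sum b c n a.
(* All members of the family share the factor exp(conf / 2), so their combinations are again of the
   form covered by [Q2_transformed]. *)
have -> : (fun x => (\sum_(i < k) a i * family (c i) (n i) x)%R) = transformed be g eta.
  apply/funext => x; rewrite /transformed /eta /cutoff_sum mulr_suml.
  by apply: eq_bigr => i _; rewrite mulrA.
have seta : csmooth (@axis R) setT eta := csmooth_cutoff_sum b_smooth b_supp c a n0.
have [p [q eta0]] : exists p q : R, forall x, ~ shell p q x -> eta x = 0 :=
  cutoff_sum_supp b_supp c a n0.
rewrite (Q2_transformed oU half_U g_smooth gv pde bdry seta eta0).
have mH := @measurable_op_half R.
apply: (le_integral (mu := @leb2 R) mH).
- exact: (reduced_integrable oU half_U g_smooth gv pde seta eta0).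
- exact: (@integrable_density_sum R (@op_half R) w mH iw C c1 kap k c n a).
- move=> x; rewrite inE => hx; have x0 := half_gt0 hx; rewrite lee_fin /reduced.
  rewrite (expR_conf be gv)//; last exact: ltW.
  (* The term -|grad conf|^2 / 4 has the favourable sign and is dropped. *)
  apply: (@le_trans _ _ (w x * rho x * (grad2 eta x - K0 * w x * eta x ^+ 2))).
    apply: ler_wpM2l; first by rewrite mulr_ge0 ?weight_ge0 ?rho_ge0.
    rewrite lerD2l lerN2.
    rewrite [leLHS]mulrC ler_wpM2l ?sqr_ge0// lerDl divr_ge0//.
    by rewrite /grad2 addr_ge0// sqr_ge0.
  rewrite /eta (cutoff_sum_sqr b_supp a n0 disj).
  rewrite (grad2_cutoff_sum b_smooth b_supp a n0 disj) mulr_sumr -sumrB mulr_sumr.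
  apply: ler_sum => i _.
  rewrite [K0 * w x * _]mulrCA -mulrBr mulrCA; apply: ler_wpM2l; first exact: sqr_ge0.
  exact: half_density_le.
Qed.

Lemma half_test c n : (0 < n)%N -> test_fun_half (family c n).
Proof.
move=> n0; apply: (transformed_test be oU half_U g_smooth (csmooth_cutoff b_smooth b_supp c n0)).
by move=> x; exact: (cutoff_outside b_supp n0).
Qed.

(** The boundary line is a null set. Measurability of the weight on the closed half-plane comes from
    its integrability on each box. *)
Lemma integral_cl_half :
  (\int[@leb2 R]_(x in @cl_half R) (w x)%:E = \int[@leb2 R]_(x in @op_half R) (w x)%:E)%E.
Proof.
have mC : measurable (@cl_half R) by apply: closed_measurable_plane; exact: closed_cl_half.
have mO := @measurable_op_half R.
have wmeas : measurable_fun (@cl_half R) (fun x => (w x)%:E).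
  have -> : @cl_half R = \bigcup_m (@cl_half R `&` box m%:R).
    apply/seteqP; split=> [x hx|x [m _ []]//].
    exists (maxn (Num.bound `|x.1|) (Num.bound `|x.2|)) => //; split=> //; apply/boxE.
    by split; apply: le_trans (ltW (archi_boundP (normr_ge0 _))) _;
      rewrite ler_nat ?leq_maxl ?leq_maxr.
  apply/measurable_fun_bigcup => m.
    by apply: measurableI => //; exact: measurable_box.
  exact: measurable_int (integrable_compact_weight (@closed_cl_half R) v_int m%:R).
have line : @cl_half R = @op_half R `|` (setT `*` [set 0]).
  apply/seteqP; split=> [[s t]|[s t] []]; rewrite /cl_half /op_half /=.
  - by rewrite le_eqVlt => /predU1P[<-|t0]; [right|left].
  - exact: ltW.
  - by move=> [_ ->].
have mL : measurable (setT `*` [set 0] : set (R * R)) by apply: measurableX.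
have L0 : (@leb2 R) (setT `*` [set 0]) = 0%E.
  rewrite /leb2 product_measure1E//.
  by rewrite [X in (_ * X)%E](lebesgue_measure_set1 (0 : R)) mule0.
rewrite line (@ge0_integral_setU _ _ R (@leb2 R)).
- rewrite (@null_set_integral _ _ R (@leb2 R) (setT `*` [set 0])) ?adde0//.
  by apply: measurable_funS wmeas => //; rewrite line; exact: subsetUr.
- exact: mO.
- exact: mL.
- by rewrite -line.
- by move=> x _; rewrite lee_fin weight_ge0.
- rewrite disj_set2E; apply/eqP/seteqP; split=> // -[s t] [/= + [_ t0]].
  by rewrite /op_half/= t0 ltxx.
Qed.

Lemma half_index : (1%:E <= ind2 K0 h0 be v)%E /\
  ((\int[@leb2 R]_(x in @cl_half R) (w x)%:E = +oo)%E -> ind2 K0 h0 be v = +oo%E).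
Proof.
have mH := @measurable_op_half R.
have w_gt0 x : @op_half R x -> 0 < rho x -> 0 < w x by move=> _; exact: weight_gt0.
have C0 : 0 <= C by rewrite divr_ge0 ?sqr_ge0// mulr_ge0// ltW.
have k0 n : (0 < n)%N -> 0 < kap n by move=> n0; rewrite invr_gt0 exprn_gt0// ltr0n.
have square : `[2^-1, 1]%classic `*` `[2^-1, 1]%classic `<=` @op_half R.
  move=> [s t] [_] /=; rewrite in_itv/= /op_half/= => /andP[+ _].
  by apply: lt_le_trans; rewrite invr_gt0.
split.
  exact: (@index_ge1 R _ w mH (weight_ge0 be v) w_gt0 iw square
    _ _ C0 c1_gt0 _ _ _ _ k0 half_test half_energy_le).
rewrite integral_cl_half.
exact: (@index_infinite R _ w mH (weight_ge0 be v) iw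
  _ _ C0 c1_gt0 _ _ _ _ k0 half_test half_energy_le).
Qed.

End HalfPlaneIndex.

Unset Implicit Arguments. Set Strict Implicit. Set Printing Implicit Defensive.

Theorem theorem4p5 (R : realType) (K0 alpha beta h0 : R) :
  0 < K0 -> -1 < alpha -> -1 < beta ->
  (forall v : R * R -> R, solution1 K0 alpha v ->
     (1%:E <= ind1 K0 alpha v)%E /\
     ((\int[@leb2 R]_x (weight alpha v x)%:E = +oo)%E -> ind1 K0 alpha v = +oo%E)) /\
  (forall v : R * R -> R, solution2 K0 h0 beta v ->
     (1%:E <= ind2 K0 h0 beta v)%E /\
     ((\int[@leb2 R]_(x in @cl_half R) (weight beta v x)%:E = +oo)%E ->
        ind2 K0 h0 beta v = +oo%E)).
Proof.
move=> K0_gt0 _ _.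
have [b [C1 [c1 [[C1_gt0 c1_gt0 b_smooth] [b01 db_le b_ge b_supp]]]]] := exists_bump R.
split=> v.
  move=> [/smooth_onP[_ v_smooth] [_ v_int]]; rewrite punctE in v_smooth.
  exact: (plane_index K0_gt0 v_smooth v_int C1_gt0 c1_gt0 b_smooth b01 db_le b_ge b_supp).
(* The boundary condition holds for every smooth extension of [v]; it is used for the extension [g]
   that the smoothness assumption provides. *)
move=> [[U [g [half_U [/[dup] gU /smooth_onP[oU g_smooth] gv]]]] [pde [bdry v_int]]].
exact: (half_index K0_gt0 oU half_U g_smooth gv pde (bdry U g half_U gU gv) v_int
  c1_gt0 b_smooth b01 db_le b_ge b_supp).
Qed.
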